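(* Let $n\ge1$ and $u\in\mathbb C$ with $u\ne0$, and let $\ddot{\mathfrak H}^{\mathfrak c}$ and $\ddot{\mathfrak H}^{\mathfrak c}_{tr}$ be the rational and the trigonometric double affine Hecke-Clifford algebras with the same parameter $u$. (1) There exists a unique superalgebra homomorphism $\iota:\ddot{\mathfrak H}^{\mathfrak c}\to\ddot{\mathfrak H}^{\mathfrak c}_{tr}$ which extends the identity map on the subalgebra $\mathcal C_n\rtimes\mathbb C S_n$ and such that $$\iota(y_i)=e^{\epsilon_i},\qquad \iota(x_i)=e^{-\epsilon_i}\Bigl(\epsilon_i^\vee-u\sum_{k<i}(1-c_ic_k)s_{ki}\Bigr)\qquad(1\le i\le n).$$ Moreover, $\iota$ is injective. (2) The homomorphism $\iota$ extends to an algebra isomorphism $$\mathbb C[y_1^{\pm1},\dots,y_n^{\pm1}]\otimes_{\mathbb C[y_1,\dots,y_n]}\ddot{\mathfrak H}^{\mathfrak c}\xrightarrow{\ \cong\ }\ddot{\mathfrak H}^{\mathfrak c}_{tr}.$$ The inverse $j$ is an extension of the identity map on $\mathcal C_n\rtimes\mathbb C S_n$ such that $$j(e^{\epsilon_i})=y_i,\qquad j(\epsilon_i^\vee)=y_ix_i+u\sum_{k<i}(1-c_ic_k)s_{ki}.$$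
   Context: $S_n$ is the symmetric group, $s_{ij}$ the transposition of $i$ and $j$, $s_i=s_{i,i+1}$. $\mathcal C_n$ is the Clifford algebra over $\mathbb C$ generated by $c_1,\dots,c_n$ with $c_i^2=1$, $c_ic_j=-c_jc_i$ ($i\ne j$); $\mathcal C_n\rtimes\mathbb C S_n$ has $\sigma c_i=c_{\sigma(i)}\sigma$. The rational double affine Hecke-Clifford algebra $\ddot{\mathfrak H}^{\mathfrak c}$ with parameter $u$ is the associative unital $\mathbb C$-algebra generated by $x_i,y_i,c_i$ ($1\le i\le n$) and $S_n$ (with the relations of the group $S_n$), subject to: $x_ix_j=x_jx_i$, $y_iy_j=y_jy_i$ for all $i,j$; $\sigma x_i=x_{\sigma(i)}\sigma$, $\sigma y_i=y_{\sigma(i)}\sigma$, $\sigma c_i=c_{\sigma(i)}\sigma$ for $\sigma\in S_n$; $c_ix_i=-x_ic_i$, $c_iy_i=y_ic_i$; $c_jx_i=x_ic_j$, $c_jy_i=y_ic_j$ for $i\neq j$; $c_i^2=1$, $c_ic_j=-c_jc_i$ for $i\neq j$; $[y_j,x_i]=u(1+c_jc_i)s_{ij}$ for $i\ne j$; $[y_i,x_i]=-u\sum_{k\neq i}(1+c_kc_i)s_{ki}$. It is a superalgebra with $c_i$ odd and all other generators even. The trigonometric double affine Hecke-Clifford algebra $\ddot{\mathfrak H}^{\mathfrak c}_{tr}$ with parameter $u$ is the $\mathbb C$-algebra generated by $e^{\pm\epsilon_i},\epsilon_i^\vee,c_i$ ($1\le i\le n$) and $S_n$ (with the relations of the group $S_n$),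 subject to: $c_i^2=1$, $c_ic_j=-c_jc_i$ ($i\ne j$); $e^{\epsilon_i}e^{-\epsilon_i}=1$ (so $e^{-\epsilon_i}$ is the two-sided inverse of $e^{\epsilon_i}$), $e^{\epsilon_i}e^{\epsilon_j}=e^{\epsilon_j}e^{\epsilon_i}$; $\epsilon_i^\vee\epsilon_j^\vee=\epsilon_j^\vee\epsilon_i^\vee$, $c_je^{\epsilon_i}=e^{\epsilon_i}c_j$ (all $i,j$); $\sigma e^{\epsilon_i}=e^{\epsilon_{\sigma(i)}}\sigma$, $\sigma c_i=c_{\sigma(i)}\sigma$ ($\sigma\in S_n$); $c_i\epsilon_i^\vee=-\epsilon_i^\vee c_i$, $c_j\epsilon_i^\vee=\epsilon_i^\vee c_j$ ($i\ne j$); $\epsilon_{i+1}^\vee s_i-s_i\epsilon_i^\vee=u(1-c_{i+1}c_i)$, $\epsilon_j^\vee s_i=s_i\epsilon_j^\vee$ ($j\ne i,i+1$); $[\epsilon_i^\vee,e^\eta]=u\sum_{k\ne i}\mathrm{sgn}(k-i)\dfrac{e^\eta-e^{s_{ki}(\eta)}}{1-e^{\mathrm{sgn}(k-i)(\epsilon_k-\epsilon_i)}}(1-c_ic_k)s_{ki}$ for all $\eta\in\bigoplus_i\mathbb Z\epsilon_i$. Here $e^{\eta}=\prod_i(e^{\epsilon_i})^{m_i}$ for $\eta=\sum_im_i\epsilon_i$, $S_n$ permutes the $\epsilon_i$, and the quotient is a Laurent polynomial in the $e^{\epsilon_i}$. It is a superalgebra with $c_i$ odd and all other generators even. The algebra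 $\mathbb C[y_1^{\pm1},\dots,y_n^{\pm1}]\otimes_{\mathbb C[y_1,\dots,y_n]}\ddot{\mathfrak H}^{\mathfrak c}$ is the localization of $\ddot{\mathfrak H}^{\mathfrak c}$ obtained by inverting $y_1,\dots,y_n$ (equivalently, by inverting the element $y_1\cdots y_n$, which is central in $\ddot{\mathfrak H}^{\mathfrak c}$). *)

(* Defs.v *)
From HB Require Import structures.
From mathcomp Require Import all_boot all_order all_algebra all_fingroup.
From mathcomp Require Import generic_quotient boolp.
From mathcomp Require Import finmap monalg zify.
From mathcomp Require Export reals complex.

Set Implicit Arguments.
Unset Strict Implicit.
Unset Printing Implicit Defensive.

Import GRing.Theory.
Local Open Scope ring_scope.
Local Open Scope quotient_scope.

(* Associative unital K-algebras: rings A with a ring morphism from K to the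
   centre of A; the scalar action is k . a = scal k * a.  The structure algType
   is not used because it requires 1 != 0, which is not known beforehand of an
   algebra given by generators and relations. *)
HB.mixin Record isAssocAlg (K : pzRingType) A of GRing.PzRing A := {
  scal : K -> A;
  scal1 : scal 1 = 1;
  scalB : forall k l : K, scal (k - l) = scal k - scal l;
  scalM : forall k l : K, scal (k * l) = scal k * scal l;
  scal_comm : forall (k : K) (a : A), scal k * a = a * scal k
}.

#[short(type="assocAlgType")]
HB.structure Definition AssocAlg (K : pzRingType) :=
  {A of GRing.PzRing A & isAssocAlg K A}.

Section ScalTheory.
Context {K : pzRingType} {A : assocAlgType K}.

Lemma scal0 : scal 0 = 0 :> A.
Proof. by rewrite -(subrr 0) scalB subrr. Qed.

Lemma scalD (k l : K) : scal (k + l) = scal k + scal l :> A.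
Proof. by rewrite -{1}[l]opprK scalB -(sub0r l) scalB scal0 sub0r opprK. Qed.

Lemma scal_sum (I : Type) (r : seq I) (F : I -> K) :
  scal (\sum_(i <- r) F i) = \sum_(i <- r) scal (F i) :> A.
Proof. exact: (big_morph _ scalD scal0). Qed.
End ScalTheory.

(* A homomorphism of K-algebras is a ring morphism that fixes the scalars. *)
Definition fixes_scalars (K : pzRingType) (A B : assocAlgType K)
    (f : {rmorphism A -> B}) : Prop :=
  forall k : K, f (scal k) = scal k.

(* ------------------------------------------------------------------------ *)
(* The free algebra on X is the monoid algebra of the free monoid on X.       *)

(* locked_with is used throughout to keep unification from unfolding the
   concrete ring operations. *)
Fact alg_key : unit. Proof. exact: tt. Qed.

Definition freeAlg (K : fieldType) (X : choiceType) : Type :=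
  {malg K[{fmonom X}]}.

Section FreeAlgebra.
Context (K : fieldType) (X : choiceType).
Local Notation malgKX := {malg K[{fmonom X}]}.
Local Notation F := (freeAlg K X).

HB.instance Definition _ := GRing.Zmodule.copy F malgKX.

Definition free_mul : F -> F -> F :=
  locked_with alg_key (fun f g => (f : malgKX) * (g : malgKX)).
Definition free_one : F := locked_with alg_key (1 : malgKX).
Definition free_scal : K -> F := locked_with alg_key (fun k => k%:MP : malgKX).

Local Lemma free_mulE (f g : F) : free_mul f g = (f : malgKX) * (g : malgKX).
Proof. by rewrite /free_mul unlock_with. Qed.
Local Lemma free_oneE : free_one = (1 : malgKX).
Proof. by rewrite /free_one unlock_with. Qed.

Fact free_mulA : associative free_mul.
Proof. by move=> f g h; rewrite !free_mulE mulrA. Qed.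
Fact free_mul1 : left_id free_one free_mul.
Proof. by move=> f; rewrite free_mulE free_oneE mul1r. Qed.
Fact free_mulr1 : right_id free_one free_mul.
Proof. by move=> f; rewrite free_mulE free_oneE mulr1. Qed.
Fact free_mulDl : left_distributive free_mul +%R.
Proof. by move=> f g h; rewrite !free_mulE; exact: mulrDl. Qed.
Fact free_mulDr : right_distributive free_mul +%R.
Proof. by move=> f g h; rewrite !free_mulE; exact: mulrDr. Qed.

HB.instance Definition _ := GRing.Zmodule_isPzRing.Build F
  free_mulA free_mul1 free_mulr1 free_mulDl free_mulDr.

Lemma freeME (f g : F) : f * g = (f : malgKX) * (g : malgKX).
Proof. exact: free_mulE. Qed.
Lemma free1E : 1 = (1 : malgKX) :> F.
Proof. exact: free_oneE. Qed.
Lemma free_scalE (k : K) : free_scal k = k%:MP.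
Proof. by rewrite /free_scal unlock_with. Qed.

Fact free_scal1 : free_scal 1 = 1.
Proof. by rewrite free_scalE free1E. Qed.
Fact free_scalB k l : free_scal (k - l) = free_scal k - free_scal l.
Proof. by rewrite !free_scalE; exact: monalgUB. Qed.
Fact free_scalM k l : free_scal (k * l) = free_scal k * free_scal l.
Proof. by rewrite !free_scalE freeME; exact: mpolyCM. Qed.
Fact free_scal_comm k f : free_scal k * f = f * free_scal k.
Proof.
rewrite !freeME free_scalE !malgM_def fgmulUg fgmulgU.
by apply: eq_bigr => w _; rewrite mul1m mulm1 mulrC.
Qed.

HB.instance Definition _ := isAssocAlg.Build K F
  free_scal1 free_scalB free_scalM free_scal_comm.

Definition fgen : X -> F := locked_with alg_key (fun x => << fmu x >> : malgKX).

Lemma fgenE x : fgen x = << fmu x >>.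
Proof. by rewrite /fgen unlock_with. Qed.

(* The coefficient of a word, and the words with a nonzero coefficient. *)
Definition fcoef (w : {fmonom X}) (f : F) : K := mcoeff w (f : malgKX).
Definition fsupp (f : F) : {fset {fmonom X}} := msupp (f : malgKX).
End FreeAlgebra.

Arguments fgen K {X} x.

(* ------------------------------------------------------------------------ *)
(* pres R: the algebra generated by X subject to l = r whenever R l r.        *)

Section Presentation.
Context (K : fieldType) (X : choiceType).
Implicit Type R : freeAlg K X -> freeAlg K X -> Prop.

(* The two-sided ideal generated by the differences l - r. *)
Inductive rel_ideal R : freeAlg K X -> Prop :=
| rel_ideal0 : rel_ideal R 0
| rel_idealD f g : rel_ideal R f -> rel_ideal R g -> rel_ideal R (f + g)
| rel_ideal_gen a l r b : R l r -> rel_ideal R (a * (l - r) * b).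

Lemma rel_idealMl R a f : rel_ideal R f -> rel_ideal R (a * f).
Proof.
elim=> [|g h _ Ig _ Ih|b l r c Rlr]; first by rewrite mulr0; apply: rel_ideal0.
  by rewrite mulrDr; apply: rel_idealD.
by rewrite !mulrA; apply: rel_ideal_gen.
Qed.

Lemma rel_idealMr R a f : rel_ideal R f -> rel_ideal R (f * a).
Proof.
elim=> [|g h _ Ig _ Ih|b l r c Rlr]; first by rewrite mul0r; apply: rel_ideal0.
  by rewrite mulrDl; apply: rel_idealD.
by rewrite -(mulrA _ c a); apply: rel_ideal_gen.
Qed.

Lemma rel_idealN R f : rel_ideal R f -> rel_ideal R (- f).
Proof. by rewrite -mulN1r; apply: rel_idealMl. Qed.

Definition rel_cong R : rel (freeAlg K X) := fun f g => `[< rel_ideal R (f - g) >].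

Lemma rel_cong_refl R : reflexive (rel_cong R).
Proof. by move=> f; apply/asboolP; rewrite subrr; apply: rel_ideal0. Qed.

Lemma rel_cong_sym R : symmetric (rel_cong R).
Proof.
by move=> f g; apply/asboolP/asboolP => /rel_idealN; rewrite opprB.
Qed.

Lemma rel_cong_trans R : transitive (rel_cong R).
Proof.
move=> g f h /asboolP fg /asboolP gh; apply/asboolP.
by rewrite -(subrK g f) -addrA; apply: rel_idealD.
Qed.

Definition rel_equiv R : equiv_rel (freeAlg K X) :=
  EquivRel (rel_cong R) (rel_cong_refl R) (@rel_cong_sym R) (@rel_cong_trans R).

Definition pres R : Type := {eq_quot (rel_equiv R)}.
HB.instance Definition _ R := Choice.on (pres R).

Definition pi_pres R : freeAlg K X -> pres R :=
  locked_with alg_key (fun f => \pi_{eq_quot (rel_equiv R)} f).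

Lemma pi_pres_surj R (a : pres R) : exists f, a = pi_pres R f.
Proof. by exists (repr a); rewrite /pi_pres unlock_with reprK. Qed.

Lemma pi_presP R f g : pi_pres R f = pi_pres R g <-> rel_ideal R (f - g).
Proof.
rewrite /pi_pres !unlock_with.
split=> [/eqquotP/asboolP //|I]; apply/eqquotP; exact/asboolP.
Qed.

Lemma pi_pres_rel R l r : R l r -> pi_pres R l = pi_pres R r.
Proof.
by move=> Rlr; apply/pi_presP; rewrite -[_ - _]mul1r -[1 * _]mulr1; apply: rel_ideal_gen.
Qed.

Section Structure.
Variable R : freeAlg K X -> freeAlg K X -> Prop.
Local Notation pi := (pi_pres R).

Definition pres_add : pres R -> pres R -> pres R :=
  locked_with alg_key (fun a b => pi (repr a + repr b)).
Definition pres_opp : pres R -> pres R :=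
  locked_with alg_key (fun a => pi (- repr a)).
Definition pres_mul : pres R -> pres R -> pres R :=
  locked_with alg_key (fun a b => pi (repr a * repr b)).

Lemma repr_pi f : rel_ideal R (repr (pi f) - f).
Proof. by apply/pi_presP; rewrite /pi_pres !unlock_with reprK. Qed.

Lemma pres_addE f g : pres_add (pi f) (pi g) = pi (f + g).
Proof.
by rewrite /pres_add unlock_with; apply/pi_presP; rewrite opprD addrACA; apply: rel_idealD; apply: repr_pi.
Qed.

Lemma pres_oppE f : pres_opp (pi f) = pi (- f).
Proof. by rewrite /pres_opp unlock_with; apply/pi_presP; rewrite -opprD; apply/rel_idealN/repr_pi. Qed.

Lemma pres_mulE f g : pres_mul (pi f) (pi g) = pi (f * g).
Proof.
rewrite /pres_mul unlock_with; apply/pi_presP.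
have -> : repr (pi f) * repr (pi g) - f * g =
  (repr (pi f) - f) * repr (pi g) + f * (repr (pi g) - g).
  by rewrite mulrBl mulrBr addrA subrK.
apply: rel_idealD; [apply: rel_idealMr | apply: rel_idealMl]; exact: repr_pi.
Qed.

Let presP (a : pres R) : exists f, a = pi f := pi_pres_surj a.

Fact pres_addA : associative pres_add.
Proof.
move=> a b c; have [f ->] := presP a; have [g ->] := presP b.
by have [h ->] := presP c; rewrite !pres_addE addrA.
Qed.

Fact pres_addC : commutative pres_add.
Proof.
move=> a b; have [f ->] := presP a; have [g ->] := presP b.
by rewrite !pres_addE addrC.
Qed.

Fact pres_add0 : left_id (pi 0) pres_add.
Proof. by move=> a; have [f ->] := presP a; rewrite pres_addE add0r. Qed.

Fact pres_addN : left_inverse (pi 0) pres_opp pres_add.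
Proof.
by move=> a; have [f ->] := presP a; rewrite pres_oppE pres_addE addNr.
Qed.

Fact pres_mulA : associative pres_mul.
Proof.
move=> a b c; have [f ->] := presP a; have [g ->] := presP b.
by have [h ->] := presP c; rewrite !pres_mulE mulrA.
Qed.

Fact pres_mul1 : left_id (pi 1) pres_mul.
Proof. by move=> a; have [f ->] := presP a; rewrite pres_mulE mul1r. Qed.

Fact pres_mulr1 : right_id (pi 1) pres_mul.
Proof. by move=> a; have [f ->] := presP a; rewrite pres_mulE mulr1. Qed.

Fact pres_mulDl : left_distributive pres_mul pres_add.
Proof.
move=> a b c; have [f ->] := presP a; have [g ->] := presP b.
by have [h ->] := presP c; rewrite !(pres_addE, pres_mulE) mulrDl.
Qed.

Fact pres_mulDr : right_distributive pres_mul pres_add.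
Proof.
move=> a b c; have [f ->] := presP a; have [g ->] := presP b.
by have [h ->] := presP c; rewrite !(pres_addE, pres_mulE) mulrDr.
Qed.

HB.instance Definition _ :=
  GRing.isZmodule.Build (pres R) pres_addA pres_addC pres_add0 pres_addN.
HB.instance Definition _ :=
  GRing.Zmodule_isPzRing.Build (pres R)
    pres_mulA pres_mul1 pres_mulr1 pres_mulDl pres_mulDr.

Fact pi_pres_zmod : zmod_morphism pi.
Proof.
move=> f g; apply/esym; rewrite -[LHS]/(pres_add (pi f) (pres_opp (pi g))).
by rewrite pres_oppE pres_addE.
Qed.

Fact pi_pres_monoid : monoid_morphism pi.
Proof. by split=> [|f g]; [reflexivity | exact: (esym (pres_mulE f g))]. Qed.

HB.instance Definition _ :=
  GRing.isZmodMorphism.Build (freeAlg K X) (pres R) pi pi_pres_zmod.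
HB.instance Definition _ :=
  GRing.isMonoidMorphism.Build (freeAlg K X) (pres R) pi pi_pres_monoid.

Definition pres_scal (k : K) : pres R := pi (scal k).

Fact pres_scal1 : pres_scal 1 = 1.
Proof. by rewrite /pres_scal scal1 rmorph1. Qed.

Fact pres_scalB k l : pres_scal (k - l) = pres_scal k - pres_scal l.
Proof. by rewrite /pres_scal scalB rmorphB. Qed.

Fact pres_scalM k l : pres_scal (k * l) = pres_scal k * pres_scal l.
Proof. by rewrite /pres_scal scalM rmorphM. Qed.

Fact pres_scal_comm k a : pres_scal k * a = a * pres_scal k.
Proof.
by have [f ->] := presP a; rewrite /pres_scal -!rmorphM scal_comm.
Qed.

HB.instance Definition _ := isAssocAlg.Build K (pres R)
  pres_scal1 pres_scalB pres_scalM pres_scal_comm.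

End Structure.

Definition pgen R (x : X) : pres R := pi_pres R (fgen K x).

Lemma pi_presM R f g : pi_pres R (f * g) = pi_pres R f * pi_pres R g.
Proof. exact: rmorphM. Qed.

Lemma pi_pres1 R : pi_pres R 1 = 1.
Proof. exact: rmorph1. Qed.

Lemma pi_presD R f g : pi_pres R (f + g) = pi_pres R f + pi_pres R g.
Proof. exact: rmorphD. Qed.

Lemma pi_pres_sum R (J : Type) (r : seq J) (P : pred J)
    (G : J -> freeAlg K X) :
  pi_pres R (\sum_(j <- r | P j) G j) = \sum_(j <- r | P j) pi_pres R (G j).
Proof. exact: raddf_sum. Qed.

Lemma pi_presN R f : pi_pres R (- f) = - pi_pres R f.
Proof. exact: rmorphN. Qed.

Lemma pi_presB R f g : pi_pres R (f - g) = pi_pres R f - pi_pres R g.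
Proof. exact: rmorphB. Qed.

Lemma pgen_rel_comm R x y z t :
  R (fgen K x * fgen K y) (fgen K z * fgen K t) ->
  pgen R x * pgen R y = pgen R z * pgen R t.
Proof. by move/pi_pres_rel; rewrite 2!pi_presM. Qed.

Lemma pgen_rel_anti R x y z t :
  R (fgen K x * fgen K y) (- (fgen K z * fgen K t)) ->
  pgen R x * pgen R y = - (pgen R z * pgen R t).
Proof. move/pi_pres_rel.
by rewrite pi_presN 2!pi_presM.
Qed.

Lemma pgen_rel_mul R x y z :
  R (fgen K x * fgen K y) (fgen K z) -> pgen R x * pgen R y = pgen R z.
Proof. by move/pi_pres_rel; rewrite pi_presM. Qed.

Lemma pgen_rel_sq R x : R (fgen K x ^+ 2) 1 -> pgen R x ^+ 2 = 1.
Proof. by move/pi_pres_rel; rewrite !expr2 pi_presM => ->; apply: rmorph1. Qed.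

(* Z/2-grading of [pres R] in which the generators x with [odd_gen x] are odd
   and the others even: the component of degree p consists of the linear
   combinations of words whose number of odd letters has parity p. *)
Definition homogeneous R (odd_gen : pred X) (p : bool) (a : pres R) : Prop :=
  exists2 f : freeAlg K X,
    forall w : {fmonom X}, w \in fsupp f -> odd (count odd_gen w) = p
    & a = pi_pres R f.

Section Evaluation.
Context (B : assocAlgType K) (g : X -> B).

Definition fword (w : {fmonom X}) : B := \prod_(x <- fmonom_val w) g x.

Definition feval (f : freeAlg K X) : B :=
  \sum_(w <- fsupp f) scal (fcoef w f) * fword w.

Lemma fword1 : fword mone = 1.
Proof. by rewrite /fword fm1 big_nil. Qed.

Lemma fwordM v w : fword (mmul v w) = fword v * fword w.
Proof. by rewrite /fword fmM big_cat. Qed.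

Lemma fevalEw (d : {fset {fmonom X}}) f : (fsupp f `<=` d)%fset ->
  feval f = \sum_(w <- d) scal (fcoef w f) * fword w.
Proof.
move=> le; rewrite [LHS](big_fset_incl _ le) => //= w wd.
by move=> /(@mcoeff_outdom _ K f) e; rewrite /fcoef e scal0 mul0r.
Qed.

Lemma fevalU k w : feval (<< k *g w >> : {malg K[{fmonom X}]}) = scal k * fword w.
Proof. by rewrite (fevalEw msuppU_le) big_seq_fset1 /fcoef mcoeffUU. Qed.

Fact feval_zmod : zmod_morphism feval.
Proof.
move=> f1 f2; rewrite (fevalEw (msuppB_le f1 f2)).
rewrite (fevalEw (fsubsetUl (fsupp f1) (fsupp f2))).
rewrite (fevalEw (fsubsetUr (fsupp f1) (fsupp f2))) -sumrB.
by apply: eq_bigr => w _; rewrite /fcoef mcoeffB scalB mulrBl.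
Qed.

HB.instance Definition _ :=
  GRing.isZmodMorphism.Build (freeAlg K X) B feval feval_zmod.

Fact feval_monoid : monoid_morphism feval.
Proof.
split=> [|f1 f2]; first by rewrite free1E fevalU scal1 fword1 mulr1.
rewrite freeME malgME.
have sumE (J : Type) (r : seq J) (G : J -> {malg K[{fmonom X}]}) :
    feval (\sum_(j <- r) G j) = \sum_(j <- r) feval (G j).
  exact: (raddf_sum feval).
rewrite sumE mulr_suml; apply: eq_bigr => v _.
rewrite sumE mulr_sumr; apply: eq_bigr => w _.
rewrite fevalU scalM fwordM -!mulrA; congr (_ * _).
by rewrite mulrA scal_comm -mulrA.
Qed.

HB.instance Definition _ :=
  GRing.isMonoidMorphism.Build (freeAlg K X) B feval feval_monoid.

Lemma feval_gen x : feval (fgen K x) = g x.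
Proof. by rewrite fgenE fevalU scal1 mul1r /fword fmU big_seq1. Qed.

Lemma feval_scal k : feval (scal k) = scal k.
Proof. by rewrite [scal k]free_scalE fevalU fword1 mulr1. Qed.

Lemma feval1 : feval 1 = 1. Proof. exact: rmorph1. Qed.
Lemma fevalD f1 f2 : feval (f1 + f2) = feval f1 + feval f2.
Proof. exact: rmorphD. Qed.
Lemma fevalN f : feval (- f) = - feval f. Proof. exact: rmorphN. Qed.
Lemma fevalM f1 f2 : feval (f1 * f2) = feval f1 * feval f2.
Proof. exact: rmorphM. Qed.
Lemma fevalMgen x y : feval (fgen K x * fgen K y) = g x * g y.
Proof. by rewrite fevalM !feval_gen. Qed.
Lemma fevalXgen x : feval (fgen K x ^+ 2) = g x ^+ 2.
Proof. by rewrite !expr2 fevalMgen. Qed.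

Context R (gP : forall l r, R l r -> feval l = feval r).

Definition pres_lift_of (_ : forall l r, R l r -> feval l = feval r)
  (a : pres R) : B := feval (repr a).

Local Notation lift := (pres_lift_of gP).

Lemma feval_ideal f : rel_ideal R f -> feval f = 0.
Proof.
elim=> [|f1 f2 _ e1 _ e2|a l r b /gP e]; first by rewrite rmorph0.
  by rewrite rmorphD /= e1 e2 addr0.
by rewrite !rmorphM rmorphB /= e subrr mulr0 mul0r.
Qed.

Lemma pres_liftE f : lift (pi_pres R f) = feval f.
Proof.
apply/eqP; rewrite -subr_eq0 -rmorphB; apply/eqP/feval_ideal; exact: repr_pi.
Qed.

Fact pres_lift_zmod : zmod_morphism lift.
Proof.
move=> a b; have [f ->] := pi_pres_surj a; have [h ->] := pi_pres_surj b.
by rewrite -rmorphB !pres_liftE rmorphB.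
Qed.

Fact pres_lift_monoid : monoid_morphism lift.
Proof.
split=> [|a b]; first by rewrite -(rmorph1 (pi_pres R)) pres_liftE rmorph1.
have [f ->] := pi_pres_surj a; have [h ->] := pi_pres_surj b.
by rewrite -rmorphM !pres_liftE rmorphM.
Qed.

HB.instance Definition _ :=
  GRing.isZmodMorphism.Build (pres R) B lift pres_lift_zmod.
HB.instance Definition _ :=
  GRing.isMonoidMorphism.Build (pres R) B lift pres_lift_monoid.

Definition pres_lift : {rmorphism pres R -> B} := lift.

Lemma pres_lift_gen x : pres_lift (pgen R x) = g x.
Proof. by rewrite [LHS]pres_liftE feval_gen. Qed.

Lemma pres_lift_scal : fixes_scalars pres_lift.
Proof. by move=> k; rewrite [LHS]pres_liftE feval_scal. Qed.

End Evaluation.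

Lemma freeE (f : freeAlg K X) : f = \sum_(w <- fsupp f)
  scal (fcoef w f) * \prod_(x <- fmonom_val w) fgen K x.
Proof.
rewrite [LHS]monalgE; apply: eq_bigr => w _.
suff -> : \prod_(x <- fmonom_val w) fgen K x = << w >> :> {malg K[{fmonom X}]}.
  rewrite freeME [X in X * _]free_scalE malgM_def fgmulUU mulr1.
  by rewrite mul1m.
case: w => r /=; elim: r => [|x r IHr]; first by rewrite big_nil free1E -fmoneE.
rewrite big_cons freeME IHr fgenE malgM_def fgmulUU mulr1 fmuE.
by rewrite -[mmul _ _]/(fmmul _ _) fmmulE.
Qed.

Lemma pres_centralP R (z : pres R) :
  (forall x, z * pgen R x = pgen R x * z) -> forall a, z * a = a * z.
Proof.
move=> zx a; have [f ->] := pi_pres_surj a.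
rewrite (freeE f) pi_pres_sum mulr_sumr mulr_suml; apply: eq_bigr => w _.
rewrite pi_presM; apply: commrM; first exact/esym/scal_comm.
elim: (fmonom_val w) => [|x r IHr].
  by rewrite big_nil pi_pres1; apply: commr1.
by rewrite big_cons pi_presM; apply: commrM (zx x) IHr.
Qed.

End Presentation.

Arguments pgen {K X} R x.

(* ------------------------------------------------------------------------ *)
(* The localization A[1/z] of a K-algebra A at a central element z: fractions
   a / z^k, where a / z^k = b / z^m iff z^(p + m) a = z^(p + k) b for some p. *)

Section CentralLocalization.
Context (K : pzRingType) (A : assocAlgType K).

Definition central (z : A) : Prop := forall a, z * a = a * z.

Section Loc.
Context (z : A) (zC : central z).

Definition loc_rel : rel (A * nat)%type := fun s t =>
  `[< exists p : nat, z ^+ (p + t.2) * s.1 = z ^+ (p + s.2) * t.1 >].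

Lemma loc_rel_refl : reflexive loc_rel.
Proof. by move=> s; apply/asboolP; exists 0%N. Qed.

Lemma loc_rel_sym : symmetric loc_rel.
Proof. by move=> s t; apply/asboolP/asboolP => -[p e]; exists p. Qed.

Lemma loc_rel_trans : transitive loc_rel.
Proof.
move=> [b m] [a k] [c l] /asboolP[/= p e] /asboolP[/= q e']; apply/asboolP.
exists (p + q + m)%N => /=.
have -> : (p + q + m + l = (q + l) + (p + m))%N by lia.
have -> : (p + q + m + k = (p + k) + (q + m))%N by lia.
by rewrite exprD -mulrA e mulrA -exprD addnC exprD -mulrA e' mulrA -exprD.
Qed.

Definition loc_equiv : equiv_rel (A * nat)%type :=
  EquivRel loc_rel loc_rel_refl loc_rel_sym loc_rel_trans.

(* zC is an argument of the type because the ring structure needs it. *)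
Definition cloc_of (_ : central z) : Type := {eq_quot loc_equiv}.
Local Notation cloc := (cloc_of zC).
HB.instance Definition _ := Choice.on cloc.

Definition frac (a : A) (k : nat) : cloc := \pi_{eq_quot loc_equiv} (a, k).

Lemma frac_eq a k b m :
  frac a k = frac b m <-> exists p, z ^+ (p + m) * a = z ^+ (p + k) * b.
Proof.
by split=> [/eqquotP/asboolP //|e]; apply/eqquotP; exact/asboolP.
Qed.

Lemma frac_surj (q : cloc) : exists a k, q = frac a k.
Proof.
by exists (repr q).1, (repr q).2; rewrite /frac -surjective_pairing reprK.
Qed.

Lemma fracP a k b m : z ^+ m * a = z ^+ k * b -> frac a k = frac b m.
Proof. by move=> e; apply/frac_eq; exists 0%N. Qed.

Let zXX i j a : z ^+ i * (z ^+ j * a) = z ^+ (i + j) * a.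
Proof. by rewrite mulrA exprD. Qed.

Let zXC a j b : a * (z ^+ j * b) = z ^+ j * (a * b).
Proof. by rewrite !mulrA; congr (_ * _); apply/esym/commr_sym/commrX/esym. Qed.

Lemma repr_frac a k : exists p,
  z ^+ (p + k) * (repr (frac a k)).1 = z ^+ (p + (repr (frac a k)).2) * a.
Proof. by apply/frac_eq; rewrite /frac -surjective_pairing reprK. Qed.

Definition loc_add : cloc -> cloc -> cloc := locked_with alg_key (fun q r =>
  frac (z ^+ (repr r).2 * (repr q).1 + z ^+ (repr q).2 * (repr r).1)
       ((repr q).2 + (repr r).2)).
Definition loc_opp : cloc -> cloc := locked_with alg_key (fun q =>
  frac (- (repr q).1) (repr q).2).
Definition loc_mul : cloc -> cloc -> cloc := locked_with alg_key (fun q r =>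
  frac ((repr q).1 * (repr r).1) ((repr q).2 + (repr r).2)).

Lemma loc_addE a k b m :
  loc_add (frac a k) (frac b m) = frac (z ^+ m * a + z ^+ k * b) (k + m).
Proof.
rewrite /loc_add unlock_with; have [p] := repr_frac a k; have [q] := repr_frac b m.
case: (repr _) (repr _) => [a' k'] [b' m'] /= eb ea.
apply/frac_eq; exists (p + q)%N; rewrite !mulrDr !zXX.
have -> : (p + q + (k + m) + m' = (q + m + m') + (p + k))%N by lia.
have -> : (p + q + (k + m) + k' = (p + k + k') + (q + m))%N by lia.
rewrite -zXX ea -[X in _ + X]zXX eb !zXX.
by congr (_ ^+ _ * _ + _ ^+ _ * _); lia.
Qed.

Lemma loc_oppE a k : loc_opp (frac a k) = frac (- a) k.
Proof.
rewrite /loc_opp unlock_with; have [p e] := repr_frac a k.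
by apply/frac_eq; exists p; rewrite !mulrN e.
Qed.

Lemma loc_mulE a k b m : loc_mul (frac a k) (frac b m) = frac (a * b) (k + m).
Proof.
rewrite /loc_mul unlock_with; have [p] := repr_frac a k; have [q] := repr_frac b m.
case: (repr _) (repr _) => [a' k'] [b' m'] /= eb ea.
apply/frac_eq; exists (p + q)%N.
have -> : (p + q + (k + m) = (q + m) + (p + k))%N by lia.
have -> : (p + q + (k' + m') = (q + m') + (p + k'))%N by lia.
have split_num i j c d : z ^+ (i + j) * (c * d) = (z ^+ j * c) * (z ^+ i * d).
  by rewrite exprD -mulrA [RHS]zXC -mulrA.
by rewrite !split_num ea eb.
Qed.

Fact loc_addA : associative loc_add.
Proof.
move=> q r s; have [a [k ->]] := frac_surj q; have [b [m ->]] := frac_surj r.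
have [c [l ->]] := frac_surj s; rewrite !loc_addE addnA !mulrDr !zXX addrA.
by congr (frac (_ ^+ _ * _ + _ ^+ _ * _ + _ ^+ _ * _) _); lia.
Qed.

Fact loc_addC : commutative loc_add.
Proof.
move=> q r; have [a [k ->]] := frac_surj q; have [b [m ->]] := frac_surj r.
by rewrite !loc_addE addrC addnC.
Qed.

Fact loc_add0 : left_id (frac 0 0) loc_add.
Proof.
move=> q; have [a [k ->]] := frac_surj q.
by rewrite loc_addE mulr0 add0r mul1r add0n.
Qed.

Fact loc_addN : left_inverse (frac 0 0) loc_opp loc_add.
Proof.
move=> q; have [a [k ->]] := frac_surj q.
by rewrite loc_oppE loc_addE mulrN addNr; apply: fracP; rewrite !mulr0.
Qed.

Fact loc_mulA : associative loc_mul.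
Proof.
move=> q r s; have [a [k ->]] := frac_surj q; have [b [m ->]] := frac_surj r.
by have [c [l ->]] := frac_surj s; rewrite !loc_mulE addnA mulrA.
Qed.

Fact loc_mul1 : left_id (frac 1 0) loc_mul.
Proof.
by move=> q; have [a [k ->]] := frac_surj q; rewrite loc_mulE mul1r add0n.
Qed.

Fact loc_mulr1 : right_id (frac 1 0) loc_mul.
Proof.
by move=> q; have [a [k ->]] := frac_surj q; rewrite loc_mulE mulr1 addn0.
Qed.

Fact loc_mulDl : left_distributive loc_mul loc_add.
Proof.
move=> q r s; have [a [k ->]] := frac_surj q; have [b [m ->]] := frac_surj r.
have [c [l ->]] := frac_surj s; rewrite !(loc_addE, loc_mulE).
apply: fracP; rewrite mulrDl -!mulrA !mulrDr !zXX.
by congr (_ ^+ _ * _ + _ ^+ _ * _); lia.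
Qed.

Fact loc_mulDr : right_distributive loc_mul loc_add.
Proof.
move=> q r s; have [a [k ->]] := frac_surj q; have [b [m ->]] := frac_surj r.
have [c [l ->]] := frac_surj s; rewrite !(loc_addE, loc_mulE).
apply: fracP; rewrite mulrDr !zXC !mulrDr !zXX.
by congr (_ ^+ _ * _ + _ ^+ _ * _); lia.
Qed.

HB.instance Definition _ :=
  GRing.isZmodule.Build cloc loc_addA loc_addC loc_add0 loc_addN.
HB.instance Definition _ := GRing.Zmodule_isPzRing.Build cloc
  loc_mulA loc_mul1 loc_mulr1 loc_mulDl loc_mulDr.

Lemma fracD a k b m : frac a k + frac b m = frac (z ^+ m * a + z ^+ k * b) (k + m).
Proof. exact: loc_addE. Qed.

Lemma fracN a k : - frac a k = frac (- a) k.
Proof. exact: loc_oppE. Qed.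

Lemma fracM a k b m : frac a k * frac b m = frac (a * b) (k + m).
Proof. exact: loc_mulE. Qed.

Definition loc_in (a : A) : cloc := frac a 0.

Fact loc_in_zmod : zmod_morphism loc_in.
Proof. by move=> a b; rewrite /loc_in fracN fracD !expr0 !mul1r. Qed.

Fact loc_in_monoid : monoid_morphism loc_in.
Proof. by split=> [|a b]; [reflexivity | rewrite /loc_in fracM]. Qed.

HB.instance Definition _ :=
  GRing.isZmodMorphism.Build A cloc loc_in loc_in_zmod.
HB.instance Definition _ :=
  GRing.isMonoidMorphism.Build A cloc loc_in loc_in_monoid.

Definition loc_scal (k : K) : cloc := loc_in (scal k).

Fact loc_scal1 : loc_scal 1 = 1.
Proof. by rewrite /loc_scal scal1 rmorph1. Qed.

Fact loc_scalB k l : loc_scal (k - l) = loc_scal k - loc_scal l.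
Proof. by rewrite /loc_scal scalB rmorphB. Qed.

Fact loc_scalM k l : loc_scal (k * l) = loc_scal k * loc_scal l.
Proof. by rewrite /loc_scal scalM rmorphM. Qed.

Fact loc_scal_comm k q : loc_scal k * q = q * loc_scal k.
Proof.
have [a [m ->]] := frac_surj q.
by rewrite /loc_scal /loc_in !fracM scal_comm addn0.
Qed.

HB.instance Definition _ := isAssocAlg.Build K cloc
  loc_scal1 loc_scalB loc_scalM loc_scal_comm.

End Loc.
End CentralLocalization.

Notation cloc zC := (cloc_of zC).

(* ------------------------------------------------------------------------ *)
(* sergeev: the algebra C_n >< K S_n.  Relations hold for all indices not restricted by
   a hypothesis.  Pitfall: in mathcomp (tau * sigma)%g maps i to
   sigma (tau i), so the product sigma tau of the informal relation
   sigma c_i = c_(sigma i) sigma is (tau * sigma)%g. *)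

Inductive sgen (n : nat) := SC of 'I_n | SS of 'S_n.
HB.instance Definition _ n := gen_eqMixin (sgen n).
HB.instance Definition _ n := gen_choiceMixin (sgen n).

Section Sergeev.
Context (K : fieldType) (n : nat).
Local Notation F := (freeAlg K (sgen n)).
Local Notation c i := (fgen K (SC i)).
Local Notation s sigma := (fgen K (SS sigma)).

Inductive sergeev_rel : F -> F -> Prop :=
| sergeev_s1 : sergeev_rel (s 1%g) 1
| sergeev_sM sigma tau : sergeev_rel (s sigma * s tau) (s (tau * sigma)%g)
| sergeev_sc sigma i : sergeev_rel (s sigma * c i) (c (sigma i) * s sigma)
| sergeev_c2 i : sergeev_rel (c i ^+ 2) 1
| sergeev_cc i j : i != j -> sergeev_rel (c i * c j) (- (c j * c i)).

Definition sergeev := pres sergeev_rel.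
HB.instance Definition _ := AssocAlg.on sergeev.
End Sergeev.

(* ------------------------------------------------------------------------ *)
(* rdaha: the rational double affine Hecke-Clifford algebra.                  *)

Inductive rgen (n : nat) :=
  RX of 'I_n | RY of 'I_n | RC of 'I_n | RS of 'S_n.
HB.instance Definition _ n := gen_eqMixin (rgen n).
HB.instance Definition _ n := gen_choiceMixin (rgen n).

Definition rodd n (g : rgen n) : bool := if g is RC _ then true else false.

Section Rational.
Context (K : fieldType) (n : nat) (u : K).
Local Notation F := (freeAlg K (rgen n)).
Local Notation x i := (fgen K (RX i)).
Local Notation y i := (fgen K (RY i)).
Local Notation c i := (fgen K (RC i)).
Local Notation s sigma := (fgen K (RS sigma)).

Inductive rdaha_rel : F -> F -> Prop :=
| rdaha_s1 : rdaha_rel (s 1%g) 1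
| rdaha_sM sigma tau : rdaha_rel (s sigma * s tau) (s (tau * sigma)%g)
| rdaha_xx i j : rdaha_rel (x i * x j) (x j * x i)
| rdaha_yy i j : rdaha_rel (y i * y j) (y j * y i)
| rdaha_sx sigma i : rdaha_rel (s sigma * x i) (x (sigma i) * s sigma)
| rdaha_sy sigma i : rdaha_rel (s sigma * y i) (y (sigma i) * s sigma)
| rdaha_sc sigma i : rdaha_rel (s sigma * c i) (c (sigma i) * s sigma)
| rdaha_cx i : rdaha_rel (c i * x i) (- (x i * c i))
| rdaha_cy i : rdaha_rel (c i * y i) (y i * c i)
| rdaha_cx_neq i j : i != j -> rdaha_rel (c j * x i) (x i * c j)
| rdaha_cy_neq i j : i != j -> rdaha_rel (c j * y i) (y i * c j)
| rdaha_c2 i : rdaha_rel (c i ^+ 2) 1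
| rdaha_cc i j : i != j -> rdaha_rel (c i * c j) (- (c j * c i))
| rdaha_yx_neq i j : i != j ->
    rdaha_rel (y j * x i - x i * y j)
              (scal u * (1 + c j * c i) * s (tperm i j))
| rdaha_yx i :
    rdaha_rel (y i * x i - x i * y i)
              (- (scal u * \sum_(k | k != i) (1 + c k * c i) * s (tperm k i))).

Definition rdaha := pres rdaha_rel.
HB.instance Definition _ := AssocAlg.on rdaha.

Definition rx (i : 'I_n) : rdaha := pgen rdaha_rel (RX i).
Definition ry (i : 'I_n) : rdaha := pgen rdaha_rel (RY i).
Definition rc (i : 'I_n) : rdaha := pgen rdaha_rel (RC i).
Definition rs (sigma : 'S_n) : rdaha := pgen rdaha_rel (RS sigma).

(* rdaha_part false and rdaha_part true are the even and the odd component. *)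
Definition rdaha_part (p : bool) (a : rdaha) : Prop :=
  homogeneous (@rodd n) p a.

End Rational.

(* ------------------------------------------------------------------------ *)
(* Laurent monomials and divided differences, in any ring with elements e i
   and e' i playing the roles of e^(eps_i) and e^(- eps_i).                   *)

Section Laurent.
Context (n : nat).

Definition sgnd (A : pzRingType) (i k : 'I_n) : A :=
  if (i < k)%N then 1 else if (k < i)%N then -1 else 0.

Definition intexp (A : pzRingType) (a a' : A) (m : int) : A :=
  match m with Posz p => a ^+ p | Negz p => a' ^+ p.+1 end.

Context (A : pzRingType) (e e' : 'I_n -> A).

Definition lmon (eta : 'I_n -> int) : A :=
  \prod_(j < n) intexp (e j) (e' j) (eta j).

(* The coordinates of sgn(k - i) (eps_k - eps_i). *)
Definition eps_root (i k : 'I_n) : 'I_n -> int := fun j =>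
  sgnd int i k * ((j == k)%:R - (j == i)%:R).

(* The Laurent polynomial
     (e^eta - e^(s_ki eta)) / (1 - e^alpha),  alpha = sgn(k - i) (eps_k - eps_i).
   As s_ki eta = eta + d alpha with d = sgn(k - i) (eta_i - eta_k), it is the
   geometric sum of the e^(eta + t alpha) over 0 <= t < d if d >= 0, and minus
   the sum over d <= t < 0 if d < 0; lquotP below checks this. *)
Definition lquot (i k : 'I_n) (eta : 'I_n -> int) : A :=
  let alpha := eps_root i k in
  match sgnd int i k * (eta i - eta k) with
  | Posz d => \sum_(0 <= t < d) lmon (fun j => eta j + alpha j *+ t)
  | Negz d => - \sum_(1 <= t < d.+2) lmon (fun j => eta j - alpha j *+ t)
  end.

End Laurent.

Section LaurentTheory.
Context (n : nat) (A : comPzRingType) (e e' : 'I_n -> A).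
Hypothesis ee' : forall j, e j * e' j = 1.
Local Notation lmon := (lmon e e').

Lemma intexp_sub (j : 'I_n) (p q : nat) :
  intexp (e j) (e' j) (p%:Z - q%:Z) = e j ^+ p * e' j ^+ q.
Proof.
have ee'X k : e j ^+ k * e' j ^+ k = 1 by rewrite -exprMn ee' expr1n.
have [le|lt] := leqP q p.
  rewrite subzn //= -{2}(subnK le) exprD -mulrA ee'X mulr1 //.
have -> : p%:Z - q%:Z = Negz (q - p).-1 by lia.
rewrite /= prednK ?subn_gt0 // -{2}(subnK (ltnW lt)) exprD mulrCA ee'X mulr1 //.
Qed.

Lemma intexpD (j : 'I_n) (m l : int) :
  intexp (e j) (e' j) (m + l) =
  intexp (e j) (e' j) m * intexp (e j) (e' j) l.
Proof.
have split_int (z : int) : exists p q : nat, z = p%:Z - q%:Z.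
  by case: z => p; [exists p, 0%N | exists 0%N, p.+1]; lia.
have [p [q ->]] := split_int m; have [p' [q' ->]] := split_int l.
have -> : p%:Z - q%:Z + (p'%:Z - q'%:Z) = (p + p')%N%:Z - (q + q')%N%:Z by lia.
by rewrite !intexp_sub !exprD mulrACA.
Qed.

Lemma lmonD (eta zeta : 'I_n -> int) :
  lmon (fun j => eta j + zeta j) = lmon eta * lmon zeta.
Proof. by rewrite /lmon -big_split; apply: eq_bigr => j _; apply: intexpD. Qed.

Lemma eq_lmon (eta zeta : 'I_n -> int) : eta =1 zeta -> lmon eta = lmon zeta.
Proof. by move=> eq; apply: eq_bigr => j _; rewrite eq. Qed.

Lemma lquotP (i k : 'I_n) (eta : 'I_n -> int) : i != k ->
  lquot e e' i k eta * (1 - lmon (eps_root i k)) =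
  lmon eta - lmon (fun j => eta (tperm k i j)).
Proof.
move=> ik; set alpha := eps_root i k.
have step (zeta : 'I_n -> int) (l : nat) :
    (\sum_(0 <= t < l) lmon (fun j => zeta j + alpha j *+ t)) * (1 - lmon alpha)
  = lmon zeta - lmon (fun j => zeta j + alpha j *+ l).
  elim: l => [|l IHl].
    rewrite big_geq // mul0r -[X in X - _](eq_lmon (eta := fun j => zeta j + alpha j *+ 0)) ?subrr //.
    by move=> j; rewrite mulr0n addr0.
  rewrite big_nat_recr //= mulrDl IHl mulrBr mulr1 -lmonD addrA subrK.
  by congr (_ - _); apply: eq_lmon => j; rewrite mulrSr addrA.
have swap j : eta (tperm k i j) = eta j + alpha j * (sgnd int i k * (eta i - eta k)).
  rewrite /alpha /eps_root /sgnd; move: ik; rewrite -val_eqE /=.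
  case: tpermP => [->|->|/eqP nk /eqP ni] ik.
  - rewrite eqxx -val_eqE /= eq_sym (negPf ik); case: ltngtP ik => //; lia.
  - rewrite eqxx -val_eqE /= (negPf ik); case: ltngtP ik => //; lia.
  - by rewrite (negPf nk) (negPf ni) subrr mulr0 mul0r addr0.
rewrite /lquot -/alpha; case: (sgnd int i k * _) swap => d swap.
  rewrite step; congr (_ - _); apply: eq_lmon => j.
  by rewrite swap pmulrn mulrzz.
pose zeta j := eta (tperm k i j).
have zetaE j : eta j = zeta j + alpha j *+ d.+1.
  by rewrite /zeta swap NegzE mulrN pmulrn mulrzz subrK.
have -> : \sum_(1 <= t < d.+2) lmon (fun j => eta j - alpha j *+ t) =
          \sum_(0 <= t < d.+1) lmon (fun j => zeta j + alpha j *+ t).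
  rewrite big_nat_rev big_add1 /=; apply: eq_big_nat => t lt.
  apply: eq_lmon => j; rewrite zetaE -addrA -mulrnBr; last lia.
  by congr (_ + _ *+ _); lia.
rewrite mulNr step opprB; congr (_ - _).
by apply: eq_lmon => j; rewrite zetaE.
Qed.

End LaurentTheory.

(* ------------------------------------------------------------------------ *)
(* tdaha: the trigonometric double affine Hecke-Clifford algebra.             *)

(* TE i, TEV i and TD i are e^(eps_i), e^(- eps_i) and eps_i^vee. *)
Inductive tgen (n : nat) :=
  TE of 'I_n | TEV of 'I_n | TD of 'I_n | TC of 'I_n | TS of 'S_n.
HB.instance Definition _ n := gen_eqMixin (tgen n).
HB.instance Definition _ n := gen_choiceMixin (tgen n).

Definition todd n (g : tgen n) : bool := if g is TC _ then true else false.

Section Trigonometric.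
Context (K : fieldType) (n : nat) (u : K).
Local Notation F := (freeAlg K (tgen n)).
Local Notation e i := (fgen K (TE i)).
Local Notation e' i := (fgen K (TEV i)).
Local Notation d i := (fgen K (TD i)).
Local Notation c i := (fgen K (TC i)).
Local Notation s sigma := (fgen K (TS sigma)).

Local Notation emon := (lmon (fun j : 'I_n => e j) (fun j : 'I_n => e' j)).
Local Notation equot := (lquot (fun j : 'I_n => e j) (fun j : 'I_n => e' j)).

Inductive tdaha_rel : F -> F -> Prop :=
| tdaha_s1 : tdaha_rel (s 1%g) 1
| tdaha_sM sigma tau : tdaha_rel (s sigma * s tau) (s (tau * sigma)%g)
| tdaha_c2 i : tdaha_rel (c i ^+ 2) 1
| tdaha_cc i j : i != j -> tdaha_rel (c i * c j) (- (c j * c i))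
| tdaha_eeV i : tdaha_rel (e i * e' i) 1
| tdaha_eVe i : tdaha_rel (e' i * e i) 1
| tdaha_ee i j : tdaha_rel (e i * e j) (e j * e i)
| tdaha_dd i j : tdaha_rel (d i * d j) (d j * d i)
| tdaha_ce i j : tdaha_rel (c j * e i) (e i * c j)
| tdaha_se sigma i : tdaha_rel (s sigma * e i) (e (sigma i) * s sigma)
| tdaha_sc sigma i : tdaha_rel (s sigma * c i) (c (sigma i) * s sigma)
| tdaha_cd i : tdaha_rel (c i * d i) (- (d i * c i))
| tdaha_cd_neq i j : i != j -> tdaha_rel (c j * d i) (d i * c j)
| tdaha_ds (i i' : 'I_n) : i' = i.+1 :> nat ->
    tdaha_rel (d i' * s (tperm i i') - s (tperm i i') * d i)
              (scal u * (1 - c i' * c i))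
| tdaha_ds_neq (i i' j : 'I_n) : i' = i.+1 :> nat -> j != i -> j != i' ->
    tdaha_rel (d j * s (tperm i i')) (s (tperm i i') * d j)
| tdaha_de i (eta : 'I_n -> int) :
    tdaha_rel (d i * emon eta - emon eta * d i)
      (scal u * \sum_(k | k != i)
         sgnd F i k * equot i k eta * (1 - c i * c k) * s (tperm k i)).

Definition tdaha := pres tdaha_rel.
HB.instance Definition _ := AssocAlg.on tdaha.

Definition te (i : 'I_n) : tdaha := pgen tdaha_rel (TE i).
Definition teV (i : 'I_n) : tdaha := pgen tdaha_rel (TEV i).
Definition td (i : 'I_n) : tdaha := pgen tdaha_rel (TD i).
Definition tc (i : 'I_n) : tdaha := pgen tdaha_rel (TC i).
Definition ts (sigma : 'S_n) : tdaha := pgen tdaha_rel (TS sigma).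

Definition tdaha_part (p : bool) (a : tdaha) : Prop :=
  homogeneous (@todd n) p a.

End Trigonometric.

Arguments rx {K n} u i.
Arguments ry {K n} u i.
Arguments rc {K n} u i.
Arguments rs {K n} u sigma.
Arguments te {K n} u i.
Arguments teV {K n} u i.
Arguments td {K n} u i.
Arguments tc {K n} u i.
Arguments ts {K n} u sigma.

Section SergeevMaps.
Context (K : fieldType) (n : nat) (u : K).

Definition sergeev_to_rgen (g : sgen n) : rdaha n u :=
  match g with SC i => rc u i | SS sigma => rs u sigma end.

Definition sergeev_to_tgen (g : sgen n) : tdaha n u :=
  match g with SC i => tc u i | SS sigma => ts u sigma end.

Lemma sergeev_to_rP l r : sergeev_rel l r ->
  feval sergeev_to_rgen l = feval sergeev_to_rgen r.
Proof.
case=> [|sigma tau|sigma i|i|i j ij].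
- rewrite feval_gen feval1; exact: (pi_pres_rel (rdaha_s1 n u)).
- rewrite fevalMgen feval_gen; apply: pgen_rel_mul; exact: rdaha_sM.
- rewrite 2!fevalMgen; apply: pgen_rel_comm; exact: rdaha_sc.
- rewrite fevalXgen feval1; apply: pgen_rel_sq; exact: rdaha_c2.
- rewrite fevalN 2!fevalMgen; apply: pgen_rel_anti; exact: rdaha_cc.
Qed.

Lemma sergeev_to_tP l r : sergeev_rel l r ->
  feval sergeev_to_tgen l = feval sergeev_to_tgen r.
Proof.
case=> [|sigma tau|sigma i|i|i j ij].
- rewrite feval_gen feval1; exact: (pi_pres_rel (tdaha_s1 n u)).
- rewrite fevalMgen feval_gen; apply: pgen_rel_mul; exact: tdaha_sM.
- rewrite 2!fevalMgen; apply: pgen_rel_comm; exact: tdaha_sc.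
- rewrite fevalXgen feval1; apply: pgen_rel_sq; exact: tdaha_c2.
- rewrite fevalN 2!fevalMgen; apply: pgen_rel_anti; exact: tdaha_cc.
Qed.

Definition sergeev_rdaha : {rmorphism sergeev K n -> rdaha n u} :=
  pres_lift sergeev_to_rP.

Definition sergeev_tdaha : {rmorphism sergeev K n -> tdaha n u} :=
  pres_lift sergeev_to_tP.

End SergeevMaps.

(* ------------------------------------------------------------------------ *)
(* The localization of rdaha obtained by inverting y_1 ... y_n, hence every
   y_i; this is K[y_i^(+-1)] (x)_(K[y_i]) rdaha. *)

Section CommutingProducts.
Context (I : eqType) (A : pzRingType) (y : I -> A).
Hypothesis yy : forall i j, y i * y j = y j * y i.
Local Notation P r := (\prod_(j <- r) y j).

Lemma prod_comm1 a (r : seq I) :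
  (forall j, j \in r -> a * y j = y j * a) -> a * P r = P r * a.
Proof.
elim: r => [|j r IHr] ay; first by rewrite big_nil mulr1 mul1r.
rewrite big_cons mulrA ay ?mem_head // -mulrA IHr ?mulrA // => l lr.
by apply: ay; rewrite in_cons lr orbT.
Qed.

Lemma perm_prod (r s : seq I) : perm_eq r s -> P r = P s.
Proof.
move=> rs; apply/esym; apply: (catCA_perm_ind (P := fun t => P t = P r)) rs _ => //.
move=> s1 s2 s3 <-; rewrite !big_cat /= !mulrA; congr (_ * _).
by apply/esym/prod_comm1 => j _; apply/esym/prod_comm1 => l _; apply: yy.
Qed.

(* If [y_j, x] = T_j for j != i and [y_i, x] = - sum_(k != i) T_k, and T_k
   exchanges y_i and y_k and commutes with the other y_j, then the product of
   all the y_j commutes with x. *)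
Lemma prod_commutator (x : A) (i : I) (T : I -> A) (r : seq I) :
    uniq r -> i \notin r ->
    (forall j, j \in r -> y j * x = x * y j + T j) ->
    (y i * x = x * y i - \sum_(k <- r) T k) ->
    (forall k, k \in r -> T k * y k = y i * T k) ->
    (forall k j, k \in r -> j \in r -> j != k -> T k * y j = y j * T k) ->
  (y i * P r) * x = x * (y i * P r).
Proof.
move=> ur ir yx yix Tk Tj.
suff E s : uniq s -> {subset s <= r} ->
    y i * (P s * x - x * P s) = \sum_(k <- s) T k * P s.
  have /(_ ur (fun j h => h)) := E r; rewrite mulrBr -mulr_suml => /eqP.
  rewrite subr_eq mulrA => /eqP ->.
  by rewrite mulrA yix mulrBl !mulrA addrC subrK.
elim: s => [|j s IHs]; first by rewrite !big_nil mulr1 mul1r subrr mulr0.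
move=> /= /andP[js us] sr; have jr : j \in r by apply: sr; rewrite mem_head.
have sr' : {subset s <= r} by move=> l ls; apply: sr; rewrite in_cons ls orbT.
pose D := P s * x - x * P s.
have PxE : P s * x = x * P s + D by rewrite /D addrC subrK.
have cT : y j * (\sum_(k <- s) T k) = (\sum_(k <- s) T k) * y j.
  rewrite mulr_sumr mulr_suml big_seq [RHS]big_seq; apply: eq_bigr => k ks.
  have jk : j != k by apply: contraNneq js => ->.
  by rewrite Tj // sr'.
have yD : y i * D = (\sum_(k <- s) T k) * P s by rewrite IHs // mulr_suml.
have yPx : y j * P s * x = x * (y j * P s) + (T j * P s + y j * D).
  by rewrite -mulrA PxE mulrDr mulrA yx // mulrDl -!mulrA addrA.
rewrite !big_cons -mulr_suml yPx [_ - _]addrC addKr mulrDr !mulrA -Tk //.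
by rewrite yy -(mulrA (y j)) yD mulrA cT -!mulrA.
Qed.

End CommutingProducts.

Section RationalLocalization.
Context (K : fieldType) (n : nat) (u : K).

Definition ry_prod : rdaha n u := \prod_(i < n) ry u i.

Lemma ry_prod_central : central ry_prod.
Proof.
have yy (i j : 'I_n) : ry u i * ry u j = ry u j * ry u i.
  by apply: pgen_rel_comm; apply: rdaha_yy.
have sy (sigma : 'S_n) (i : 'I_n) : rs u sigma * ry u i = ry u (sigma i) * rs u sigma.
  by apply: pgen_rel_comm; apply: rdaha_sy.
have cy (i j : 'I_n) : rc u j * ry u i = ry u i * rc u j.
  case: (eqVneq i j) => [<-|ij]; apply: pgen_rel_comm; first exact: rdaha_cy.
  exact: rdaha_cy_neq.
have Pcomm (a : rdaha n u) :
    (forall i, a * ry u i = ry u i * a) -> ry_prod * a = a * ry_prod.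
  by move=> ay; apply/esym/prod_comm1 => i _; apply: ay.
apply: pres_centralP => -[i|i|i|sigma]; rewrite -/(rdaha n u).
- pose T k := scal u * ((1 + rc u k * rc u i) * rs u (tperm k i)).
  have cTy (k j : 'I_n) : scal u * ((1 + rc u k * rc u i) * rs u (tperm k i)) * ry u j =
      ry u (tperm k i j) * T k.
    have com : (1 + rc u k * rc u i) * ry u (tperm k i j) =
               ry u (tperm k i j) * (1 + rc u k * rc u i).
      by rewrite mulrDl mulrDr mul1r mulr1 -mulrA cy mulrA cy mulrA.
    rewrite -!mulrA sy (mulrA (1 + _)) com -mulrA /T.
    by rewrite mulrA scal_comm -mulrA.
  pose r := [seq k <- index_enum 'I_n | k != i].
  have ur : uniq r by rewrite filter_uniq // index_enum_uniq.
  have ri k : (k \in r) = (k != i) by rewrite mem_filter mem_index_enum andbT.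
  have -> : ry_prod = ry u i * \prod_(j <- r) ry u j.
    have <- : \prod_(j <- i :: r) ry u j = ry u i * \prod_(j <- r) ry u j.
      by rewrite big_cons.
    apply: (perm_prod yy).
    apply: uniq_perm; rewrite ?index_enum_uniq //= ?ur ?ri ?eqxx //.
    by move=> k; rewrite in_cons ri mem_index_enum; case: eqP.
  apply: (prod_commutator yy (T := T)) => //; rewrite ?ri ?eqxx //.
  + move=> j; rewrite ri => ji; apply/eqP; rewrite addrC -subr_eq; apply/eqP.
    have ij : i != j by rewrite eq_sym.
    have := pi_pres_rel (rdaha_yx_neq u ij).
    rewrite pi_presB !pi_presM => ->.
    rewrite /T pi_presD pi_pres1 !pi_presM tpermC -mulrA; exact: erefl.
  + apply/eqP; rewrite addrC -subr_eq; apply/eqP.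
    have := pi_pres_rel (rdaha_yx u i).
    rewrite pi_presB !pi_presM => ->.
    rewrite pi_presN pi_presM pi_pres_sum big_filter mulr_sumr; congr (- _).
    apply: eq_bigr => k _.
    rewrite /T pi_presM pi_presD pi_pres1 !pi_presM; exact: erefl.
  + by move=> k; rewrite ri => ki; rewrite [LHS]cTy tpermL.
  + move=> k j; rewrite !ri => ki ji jk.
    by rewrite [LHS]cTy tpermD // eq_sym.
- by apply: Pcomm => j; apply: yy.
- by apply: Pcomm => j; apply: cy.
- rewrite -[pgen _ _]/(rs u sigma) /ry_prod.
  have sP (r : seq 'I_n) : rs u sigma * \prod_(i <- r) ry u i =
      (\prod_(i <- [seq sigma i | i <- r]) ry u i) * rs u sigma.
    elim: r => [|i r IHr]; first by rewrite !big_nil mulr1 mul1r.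
    by rewrite /= !big_cons mulrA sy -mulrA IHr mulrA.
  rewrite sP; congr (_ * _); apply: (perm_prod yy).
  apply: uniq_perm; rewrite ?map_inj_uniq ?index_enum_uniq //.
    exact: perm_inj.
  move=> j; rewrite mem_index_enum; apply/esym/mapP.
  by exists (sigma^-1%g j); rewrite ?mem_index_enum ?permKV.
Qed.

Definition rdaha_loc := cloc ry_prod_central.
HB.instance Definition _ := AssocAlg.on rdaha_loc.

Definition rdaha_to_loc : {rmorphism rdaha n u -> rdaha_loc} :=
  loc_in ry_prod_central.

End RationalLocalization.

Arguments sergeev_rdaha {K n} u.
Arguments sergeev_tdaha {K n} u.
Arguments rdaha_to_loc {K n} u.

Section Iota.
Context (K : fieldType) (n : nat) (u : K).

Definition superalg_hom (f : {rmorphism rdaha n u -> tdaha n u}) : Prop :=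
  fixes_scalars f /\ forall p a, rdaha_part p a -> tdaha_part p (f a).

Definition iota_spec (f : {rmorphism rdaha n u -> tdaha n u}) : Prop :=
  [/\ superalg_hom f,
      forall a : sergeev K n, f (sergeev_rdaha u a) = sergeev_tdaha u a,
      forall i : 'I_n, f (ry u i) = te u i
    & forall i : 'I_n, f (rx u i) = teV u i *
        (td u i - scal u * \sum_(k < n | (k < i)%N)
                             (1 - tc u i * tc u k) * ts u (tperm k i))].

Definition j_spec (j : {rmorphism tdaha n u -> rdaha_loc n u}) : Prop :=
  [/\ forall a : sergeev K n,
        j (sergeev_tdaha u a) = rdaha_to_loc u (sergeev_rdaha u a),
      forall i : 'I_n, j (te u i) = rdaha_to_loc u (ry u i)
    & forall i : 'I_n, j (td u i) = rdaha_to_loc u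
        (ry u i * rx u i + scal u * \sum_(k < n | (k < i)%N)
                             (1 - rc u i * rc u k) * rs u (tperm k i))].
End Iota.

(* Main.v *)
Require Import Defs.
From HB Require Import structures.
From mathcomp Require Import all_boot all_order all_algebra all_fingroup.
From mathcomp Require Import generic_quotient boolp finmap monalg zify.
From mathcomp Require Import reals complex.

Set Implicit Arguments.
Unset Strict Implicit.
Unset Printing Implicit Defensive.

Import GRing.Theory.
Local Open Scope ring_scope.
Local Open Scope complex_scope.

(** Both algebras contain the Sergeev algebra generated by the c_i and S_n, and
    in it the elements T_ik = (1 + c_k c_i) s_ik ([exch]).  All non-trivial
    relations are governed by these: the rational ones read
      [x_i, y_l] = u sum_(k <> i) (delta_li - delta_lk) T_ik,
    and u (1 - c_i c_k) s_ik = u T_ik is the term occurring in the trigonometric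
    ones.  Moreover T_ik y_l = y_(s_ik l) T_ik, and T_ik x_k = x_i T_ki.

    Let J_i = sum_(k < i) T_ik be the Jucys-Murphy elements ([jucys]) and
    D_i = y_i x_i + u J_i ([cherednik]).  The relations of the rational algebra
    other than x_i x_j = x_j x_i imply, for i < j,
      [D_i, D_j] = y_i y_j [x_i, x_j]                       ([cherednik_br]),
      [D_i, y_l] = u sum_(k <> i) (delta_li - delta_lk) y_min(i,k) T_ik
                                                            ([cherednik_y]).
    The quotients (e^eta - e^(s eta)) / (1 - e^alpha) satisfy a twisted Leibniz
    rule in eta ([squotS]), so the second formula is equivalent to the commutator
    of D_i with every Laurent monomial.  Hence, once the y_i are invertible,
    (x_i, y_i) satisfy the rational relations exactly when (D_i, y_i) satisfy the
    trigonometric ones ([rational_to_trigonometric],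
    [trigonometric_to_rational]), with x_i = y_i^-1 (D_i - u J_i).  This gives
    homomorphisms from the rational algebra to the trigonometric one and from the
    latter to the localization, and they are mutually inverse after localizing
    because they are so on generators.

    Injectivity before localizing is the statement that z = y_1 ... y_n is not a
    zero divisor of the rational algebra A ([ry_prod_regular]).  This follows from
    a module on which the y_i act freely.  Let M = A[Y_1, ..., Y_n] be the
    polynomials with coefficients in A: the y_i act as multiplication by the Y_i,
    the c_i and S_n act in the obvious way, and x_i acts by
      f h |-> f x_i h + u sum_(k <> i) (f - s_ik f) / (Y_i - Y_k) T_ik h.
    These operators satisfy the rational relations ([ypoly_action]); that the x_i
    commute follows from the Jacobi identity, since [x_i, x_j] commutes with all
    Y_l and vanishes on constants ([xmulC]).  Evaluation of Y_i at y_i is an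
    A-linear map M -> A sending 1 to 1, so if z a = 0 then Y_1 ... Y_n (a . 1) = 0
    in M, hence a . 1 = 0 and a = 0. *)

(** * The exchange elements and the Jucys-Murphy elements *)

Record sergeev_action (n : nat) (B : pzRingType) (c : 'I_n -> B)
    (s : 'S_n -> B) : Prop := SergeevAction {
  sgv_s1 : s 1%g = 1;
  sgv_sM : forall sigma tau, s sigma * s tau = s (tau * sigma)%g;
  sgv_sc : forall sigma i, s sigma * c i = c (sigma i) * s sigma;
  sgv_c2 : forall i, c i * c i = 1;
  sgv_cc : forall i j, i != j -> c i * c j = - (c j * c i)
}.

Record x_like (n : nat) (B : pzRingType) (c : 'I_n -> B)
    (s : 'S_n -> B) (x : 'I_n -> B) : Prop := XLike {
  xl_s : forall sigma i, s sigma * x i = x (sigma i) * s sigma;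
  xl_c : forall i, c i * x i = - (x i * c i);
  xl_c_neq : forall i j, i != j -> c j * x i = x i * c j
}.

Record y_like (n : nat) (B : pzRingType) (c : 'I_n -> B)
    (s : 'S_n -> B) (y : 'I_n -> B) : Prop := YLike {
  yl_s : forall sigma i, s sigma * y i = y (sigma i) * s sigma;
  yl_c : forall i j, c j * y i = y i * c j;
  yl_y : forall i j, y i * y j = y j * y i
}.

(** Both [exch] and [jucys] are locked so that rewriting with the ring axioms does
    not look inside them. *)
HB.lock Definition exch (n : nat) (B : pzRingType) (c : 'I_n -> B) (s : 'S_n -> B)
  (i k : 'I_n) : B := (1 + c k * c i) * s (tperm k i).

HB.lock Definition jucys (n : nat) (B : pzRingType) (c : 'I_n -> B) (s : 'S_n -> B)
  (i : 'I_n) : B := \sum_(k < n | (k < i)%N) exch c s i k.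

Arguments exch {n B} c s i k.
Arguments jucys {n B} c s i.

Lemma exch_def n (B : pzRingType) (c : 'I_n -> B) s i k :
  exch c s i k = (1 + c k * c i) * s (tperm k i).
Proof. by rewrite exch.unlock. Qed.

Lemma jucys_def n (B : pzRingType) (c : 'I_n -> B) s i :
  jucys c s i = \sum_(k < n | (k < i)%N) exch c s i k.
Proof. by rewrite jucys.unlock. Qed.

Section Exchange.
Context (n : nat) (B : pzRingType) (c : 'I_n -> B) (s : 'S_n -> B).
Hypothesis cs : sergeev_action c s.
Local Notation T := (exch c s).
Local Notation J := (jucys c s).

(** The form in which these elements occur in the trigonometric relations. *)
Lemma exchE i k : i != k -> T i k = (1 - c i * c k) * s (tperm k i).
Proof. by move=> ik; rewrite !exch_def (sgv_cc cs ik) opprK. Qed.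

Lemma exch_s sigma i k : s sigma * T i k = T (sigma i) (sigma k) * s sigma.
Proof.
rewrite !exch_def mulrA mulrDr mulr1 mulrA (sgv_sc cs) -(mulrA _ _ (c i)).
rewrite (sgv_sc cs) mulrA -{1}[s sigma]mul1r -mulrDl -!mulrA; congr (_ * _).
by rewrite !(sgv_sM cs) -tpermJ conjgC.
Qed.

(** Under conjugation by the c_j the element T_ik behaves like x_i, because
    s_ik exchanges c_i and c_k: it anticommutes with c_i and commutes with c_k. *)
Lemma exch_c i k : i != k -> c i * T i k = - (T i k * c i).
Proof.
move=> ik; have ki : k != i by rewrite eq_sym.
rewrite !exch_def -mulrA (sgv_sc cs) tpermR !mulrA -mulNr; congr (_ * _).
rewrite mulrDl mulrDr mul1r mulr1 mulrA (sgv_cc cs ik) mulNr -mulrA (sgv_c2 cs) mulr1.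
rewrite -[c k * c i * c k]mulrA (sgv_cc cs ik) mulrN mulrA (sgv_c2 cs) mul1r.
by rewrite opprD opprK addrC.
Qed.

Lemma exch_c_neq i j k : i != k -> i != j -> c j * T i k = T i k * c j.
Proof.
move=> ik ij; have ki : k != i by rewrite eq_sym.
rewrite !exch_def -mulrA (sgv_sc cs) !mulrA; congr (_ * _).
have [<-|kj] := eqVneq k j.
  rewrite tpermL mulrDl mulrDr mul1r mulr1 mulrA (sgv_c2 cs) mul1r.
  by rewrite -mulrA (sgv_c2 cs) mulr1 addrC.
rewrite tpermD // mulrDl mulrDr mul1r mulr1; congr (_ + _).
have jk : j != k by rewrite eq_sym.
have ji : j != i by rewrite eq_sym.
by rewrite mulrA (sgv_cc cs jk) mulNr -mulrA (sgv_cc cs ji) mulrN opprK mulrA.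
Qed.

Lemma exch_y y i k l : y_like c s y -> T i k * y l = y (tperm k i l) * T i k.
Proof.
move=> yl; rewrite !exch_def -mulrA (yl_s yl) mulrA; rewrite [RHS]mulrA; congr (_ * _).
by rewrite mulrDl mulrDr mul1r mulr1 -mulrA (yl_c yl) mulrA (yl_c yl) mulrA.
Qed.

Section XLikeExchange.
Variable (x : 'I_n -> B).
Hypothesis xl : x_like c s x.

(** Moving x_j to the left past 1 + c_j c_i and s_ij turns the sign of c_j c_i,
    that is, T_ij into T_ji.  This asymmetry is what makes the cross terms in
    [D_i, D_j] cancel. *)
Lemma exch_x i j : i != j -> T i j * x j = x i * T j i.
Proof.
move=> ij; have ji : j != i by rewrite eq_sym.
rewrite !exch_def -mulrA (xl_s xl) tpermL tpermC !mulrA; congr (_ * _).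
rewrite mulrDl mulrDr mul1r mulr1 -mulrA (xl_c xl) mulrN mulrA (xl_c_neq xl ij).
by rewrite -mulrA -mulrN (sgv_cc cs ji) opprK.
Qed.

Lemma exch_x_neq i j l : l != i -> l != j -> T i j * x l = x l * T i j.
Proof.
move=> li lj; rewrite !exch_def -mulrA (xl_s xl) tpermD 1?eq_sym // [RHS]mulrA mulrA.
congr (_ * _); rewrite mulrDl mulrDr mul1r mulr1 -mulrA (xl_c_neq xl li).
by rewrite mulrA (xl_c_neq xl lj) mulrA.
Qed.

(** Only the term k = i of J_j does not commute with x_i. *)
Lemma exch_jucys_comm (i j : 'I_n) : (i < j)%N ->
  x i * J j - J j * x i = x i * T j i - x j * T i j.
Proof.
move=> ij; have ji : j != i by rewrite -val_eqE /= gtn_eqF.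
rewrite !jucys_def (bigD1 i) //= mulrDr mulrDl (exch_x ji) opprD addrACA.
rewrite mulr_sumr mulr_suml [X in _ + (X - _)](_ : _ = \sum_(k < n | (k < j)%N && (k != i)) T j k * x i).
  by rewrite subrr addr0.
apply: eq_bigr => k /andP[_ ki]; rewrite exch_x_neq //; first by rewrite eq_sym.
by rewrite eq_sym.
Qed.

Lemma jucys_x_comm (i j : 'I_n) : (i < j)%N -> J i * x j = x j * J i.
Proof.
move=> ij; rewrite !jucys_def mulr_sumr mulr_suml; apply: eq_bigr => k ki.
by rewrite exch_x_neq // -val_eqE /= gtn_eqF // (ltn_trans ki).
Qed.

End XLikeExchange.

Lemma jucys_s (sigma : 'S_n) (j : 'I_n) : sigma j = j -> (forall k, ((sigma k < j) = (k < j))%N) ->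
  s sigma * J j = J j * s sigma.
Proof.
move=> sj sk; rewrite !jucys_def mulr_sumr mulr_suml.
rewrite [RHS](reindex_inj (@perm_inj _ sigma)) /=.
by apply: eq_big => [k|k _]; rewrite ?sk // exch_s sj.
Qed.

Lemma jucys_c i : c i * J i = - (J i * c i).
Proof.
rewrite !jucys_def mulr_sumr mulr_suml -sumrN; apply: eq_bigr => k ki.
by rewrite exch_c // -val_eqE /= gtn_eqF.
Qed.

Lemma jucys_c_neq i j : i != j -> c j * J i = J i * c j.
Proof.
move=> ij; rewrite !jucys_def mulr_sumr mulr_suml; apply: eq_bigr => k ki.
by rewrite exch_c_neq // -val_eqE /= gtn_eqF.
Qed.

(** J_j commutes with everything that involves only indices below j. *)
Lemma jucysC (i j : 'I_n) : (i < j)%N -> J i * J j = J j * J i.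
Proof.
move=> ij; have jneq (k : 'I_n) : (k < j)%N -> j != k.
  by move=> kj; rewrite -val_eqE /= gtn_eqF.
rewrite [J i]jucys_def [LHS]mulr_suml [RHS]mulr_sumr; apply: eq_bigr => k ki.
have kj := ltn_trans ki ij.
rewrite !exch_def -mulrA jucys_s; last first.
- by move=> l; case: tpermP => [->|->|//]; rewrite ij kj.
- by rewrite tpermD // eq_sym jneq.
rewrite !mulrA; congr (_ * _); rewrite mulrDl mulrDr mul1r mulr1; congr (_ + _).
by rewrite -mulrA (jucys_c_neq (jneq _ ij)) mulrA (jucys_c_neq (jneq _ kj)) mulrA.
Qed.

(** Conjugation by s_i maps J_i to J_(i+1) without its term k = i; that term
    accounts for the inhomogeneous relation between epsilon_(i+1)^vee and s_i. *)
Lemma jucys_adj (i i' : 'I_n) : i' = i.+1 :> nat ->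
  J i' * s (tperm i i') - s (tperm i i') * J i = 1 - c i' * c i.
Proof.
move=> ii'; have i'i : i' != i by rewrite -val_eqE /= ii' gtn_eqF.
rewrite [J i']jucys_def (bigD1 i) /= ?ii' // mulrDl -addrA.
rewrite [X in _ + X](_ : _ = 0) ?addr0.
  by rewrite exchE // -mulrA (sgv_sM cs) tperm2 (sgv_s1 cs) mulr1.
apply/eqP; rewrite subr_eq0; apply/eqP.
rewrite [J i]jucys_def mulr_suml mulr_sumr; apply: eq_big => [k|k /andP[ki' ki]].
  by rewrite -val_eqE /= ltnS andbC ltn_neqAle.
rewrite exch_s tpermL tpermD //; first by rewrite eq_sym.
by rewrite -val_eqE /= gtn_eqF // ii'.
Qed.

Lemma jucys_far (i i' j : 'I_n) : i' = i.+1 :> nat -> j != i -> j != i' ->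
  J j * s (tperm i i') = s (tperm i i') * J j.
Proof.
move=> ii' ji ji'; rewrite jucys_s //; first by rewrite tpermD 1?eq_sym.
move: ji ji'; rewrite -!val_eqE /= => ji ji' k.
by case: tpermP => [->|->|//]; lia.
Qed.

End Exchange.

(** * Laurent monomials and their divided differences *)

Section Brackets.
Context (B : pzRingType).
Implicit Types a b : B.
Local Notation br a b := (a * b - b * a).

Lemma brDl a b d : br (a + b) d = br a d + br b d.
Proof. by rewrite mulrDl mulrDr opprD addrACA. Qed.

Lemma brDr a b d : br a (b + d) = br a b + br a d.
Proof. by rewrite mulrDl mulrDr opprD addrACA. Qed.

Lemma brMr a b d : br a (b * d) = br a b * d + b * br a d.
Proof. by rewrite mulrBl mulrBr !mulrA addrA subrK. Qed.

Lemma brBl a b d : br (a - b) d = br a d - br b d.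
Proof.
rewrite mulrBl mulrBr !opprB addrACA [RHS]addrACA; congr (_ + _).
by rewrite addrC.
Qed.

Lemma brMl a b d : br (a * b) d = a * br b d + br a d * b.
Proof. by rewrite mulrBr mulrBl !mulrA addrA subrK. Qed.

Lemma brZl w a b : (forall d, w * d = d * w) -> br (w * a) b = w * br a b.
Proof. by move=> wC; rewrite mulrBr !mulrA [w * b]wC. Qed.

Lemma brZr w a b : (forall d, w * d = d * w) -> br a (w * b) = w * br a b.
Proof. by move=> wC; rewrite mulrBr !mulrA [w * a]wC. Qed.

Lemma inv_commutes a a' b : a * a' = 1 -> a' * a = 1 -> a * b = b * a ->
  a' * b = b * a'.
Proof.
move=> aa' a'a ab; rewrite -[LHS]mulr1 -aa' -mulrA (mulrA b) -ab.
by rewrite !mulrA a'a mul1r.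
Qed.

End Brackets.

Lemma commuting_prod_split (n : nat) (B : pzRingType) (f : 'I_n -> B) (l : 'I_n) :
  (forall i j, f i * f j = f j * f i) ->
  \prod_(j < n) f j = f l * \prod_(j | j != l) f j.
Proof.
move=> fC; rewrite -[in RHS]big_filter -(big_cons _ _ _ _ xpredT f).
apply: perm_prod => //; apply: uniq_perm => [||j]; rewrite ?index_enum_uniq //=.
  by rewrite mem_filter eqxx filter_uniq // index_enum_uniq.
by rewrite in_cons mem_filter !mem_index_enum andbT; case: eqP.
Qed.

Section IntVectors.
Context (n : nat).

Definition vadd (eta : 'I_n -> int) (l : 'I_n) : 'I_n -> int :=
  fun j => eta j + (j == l)%:R.

(** The equivalence in the step is what makes an induction over vectors with
    entries of either sign possible: it is used upwards and downwards. *)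
Lemma int_vec_ind (P : ('I_n -> int) -> Prop) :
  P (fun=> 0) -> (forall eta l, P eta <-> P (vadd eta l)) -> forall eta, P eta.
Proof.
move=> P0 Pv eta.
have shift zeta l (m : int) : P zeta -> P (fun j => zeta j + m * (j == l)%:R).
  move=> Pz; elim/int_rect: m => [|m IHm|m IHm].
  - by rewrite (_ : (fun _ => _) = zeta) //; apply/funext => j; rewrite mul0r addr0.
  - move/Pv: IHm => /(_ l); congr P; apply/funext => j; rewrite /vadd; lia.
  - apply/(Pv _ l); move: IHm; congr P; apply/funext => j; rewrite /vadd; lia.
have H (r : seq 'I_n) : uniq r -> P (fun j => if j \in r then eta j else 0).
  elim: r => [|l r IHr] //= /andP[lr /IHr Pr].
  have := shift _ l (eta l) Pr; congr P.
  apply/funext => j; rewrite in_cons; have [->|jl] /= := eqVneq j l.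
    by rewrite (negPf lr) mulr1 add0r.
  by rewrite mulr0 addr0.
have := H _ (enum_uniq 'I_n); congr P; apply/funext => j.
by rewrite mem_enum inE.
Qed.

End IntVectors.

Section LaurentMonomials.
Context (n : nat) (B : pzRingType) (e e' : 'I_n -> B).
Hypotheses (ee' : forall i, e i * e' i = 1) (e'e : forall i, e' i * e i = 1).
Hypothesis eC : forall i j, e i * e j = e j * e i.
Local Notation mon := (lmon e e').

Lemma eq_mon eta zeta : eta =1 zeta -> mon eta = mon zeta.
Proof. by move/funext ->. Qed.

Lemma lmon0 : mon (fun=> 0) = 1.
Proof. by rewrite /lmon big1. Qed.

Let eVC i j : e' i * e j = e j * e' i.
Proof. exact: inv_commutes (ee' i) (e'e i) (eC i j). Qed.

Let eVVC i j : e' i * e' j = e' j * e' i.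
Proof. by apply: inv_commutes (ee' i) (e'e i) _; rewrite eVC. Qed.

Let intexpC i j m l :
  intexp (e i) (e' i) m * intexp (e j) (e' j) l =
  intexp (e j) (e' j) l * intexp (e i) (e' i) m.
Proof.
by case: m l => p [q|q] /=; apply/commrX/commr_sym/commrX; rewrite /GRing.comm.
Qed.

Lemma lmonS eta l : mon (vadd eta l) = e l * mon eta.
Proof.
rewrite /mon !(commuting_prod_split l) => [|i j|i j]; try exact: intexpC.
rewrite mulrA; congr (_ * _).
  rewrite /vadd eqxx; case: (eta l) => [p|[|p]].
  - by rewrite -[_ + _]/(Posz (p + 1)) addn1 /= exprS.
  - by rewrite /= expr1 ee'.
  - have -> : Negz p.+1 + true%:R = Negz p by lia.
    by rewrite /= [e' l ^+ p.+2]exprS mulrA ee' mul1r.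
apply: eq_bigr => j jl.
by rewrite /vadd (negPf jl) addr0.
Qed.

(** Monomials follow a permutation of the variables; this is used with a = T_ik,
    which moves e^eta to e^(s_ik eta). *)
Lemma lmon_exch a (sigma : 'S_n) :
  (forall i, a * e i = e (sigma i) * a) ->
  forall eta, a * mon (fun j => eta (sigma j)) = mon eta * a.
Proof.
move=> ae; elim/int_vec_ind => [|eta l]; first by rewrite lmon0 mulr1 mul1r.
rewrite lmonS (_ : (fun j => vadd eta l (sigma j)) =
  vadd (fun j => eta (sigma j)) (sigma^-1%g l)); last first.
  apply/funext => j; rewrite /vadd; congr (_ + _); congr (nat_of_bool _)%:R.
  by apply/eqP/eqP => [<-|->]; rewrite ?permK ?permKV.
rewrite lmonS mulrA ae permKV -!mulrA; split=> [-> //|E].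
by rewrite -[LHS]mul1r -[RHS]mul1r -(e'e l) -!mulrA E.
Qed.

(** The pairing of the coordinate vector l with the root epsilon_i - epsilon_k. *)
Definition qsign (A : pzRingType) (i k l : 'I_n) : A := (l == i)%:R - (l == k)%:R.

(** The geometric sum of the e^(eta + t alpha) over 0 <= t < d, where a sum over a
    reversed range counts negatively.  As a function of the integer d it satisfies
    the single recursion [gsumS], whatever the sign of d. *)
Definition gsum (alpha eta : 'I_n -> int) (d : int) : B :=
  match d with
  | Posz d => \sum_(0 <= t < d) mon (fun j => eta j + alpha j *+ t)
  | Negz d => - \sum_(1 <= t < d.+2) mon (fun j => eta j - alpha j *+ t)
  end.

Lemma gsumS alpha eta d :
  gsum alpha eta (d + 1) = gsum alpha eta d + mon (fun j => eta j + alpha j * d).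
Proof.
have telescope (x y z : B) : x = y -> z = z - x + y by move=> ->; rewrite subrK.
case: d => [p|[|p]].
- rewrite -[_ + _]/(Posz (p + 1)) addn1 /= big_nat_recr //=; congr (_ + _).
  by apply: eq_mon => j; rewrite pmulrn mulrzz.
- rewrite -[_ + _]/(Posz 0) /= big_geq // big_nat1 -sub0r.
  by apply: telescope; apply: eq_mon => j; rewrite mulrN1.
- have -> : Negz p.+1 + 1 = Negz p by lia.
  rewrite /= [in RHS]big_nat_recr //= opprD.
  by apply: telescope; apply: eq_mon => j; rewrite NegzE mulrN pmulrn mulrzz.
Qed.

Lemma gsum_vadd alpha eta d l : gsum alpha (vadd eta l) d = e l * gsum alpha eta d.
Proof.
case: d => d /=; rewrite ?mulrN ?mulr_sumr; [|congr (- _)];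
  apply: eq_bigr => t _; rewrite -lmonS; apply: eq_mon => j;
  by rewrite /vadd addrAC.
Qed.

Definition squot i k eta : B := sgnd B i k * lquot e e' i k eta.

Lemma lquot_gsum i k eta :
  lquot e e' i k eta = gsum (eps_root i k) eta (sgnd int i k * (eta i - eta k)).
Proof. by []. Qed.

Lemma squot0 i k : squot i k (fun=> 0) = 0.
Proof. by rewrite /squot lquot_gsum subrr mulr0 /= big_geq // mulr0. Qed.

(** The twisted Leibniz rule of the divided difference for the product of e_l and
    e^eta.  Adding epsilon_l changes the number of terms of the geometric sum by
    -1, 0 or 1; the term gained or lost is e_min(i,k) e^(s_ik eta) in all cases,
    since the root alpha is oriented by the order of i and k. *)
Lemma squotS i k eta l : i != k ->
  squot i k (vadd eta l) = e l * squot i k eta +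
    qsign B i k l * e (if (i < k)%N then i else k) *
    mon (fun j => eta (tperm k i j)).
Proof.
move=> ik; rewrite /squot !lquot_gsum gsum_vadd.
set d := sgnd int i k * (eta i - eta k); set al := eps_root i k.
(* The end point of the geometric progression is the swapped exponent. *)
have swap : (fun j => eta (tperm k i j)) = (fun j => eta j + al j * d).
  apply/funext => j; rewrite /d /al /eps_root /sgnd; move: ik.
  rewrite -val_eqE /=; case: tpermP => [->|->|/eqP nk /eqP ni] ik.
  - rewrite eqxx -val_eqE /= eq_sym (negPf ik); case: ltngtP ik => //; lia.
  - rewrite eqxx -val_eqE /= (negPf ik); case: ltngtP ik => //; lia.
  - by rewrite (negPf nk) (negPf ni) subrr mulr0 mul0r addr0.
rewrite swap.
have -> : sgnd int i k * (vadd eta l i - vadd eta l k) =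
          d + sgnd int i k * qsign int i k l.
  by rewrite /d /vadd /qsign ![l == _]eq_sym; lia.
have back : gsum al eta (d - 1) =
    gsum al eta d - mon (fun j => eta j + al j * (d - 1)).
  by apply/eqP; rewrite eq_sym subr_eq -gsumS subrK.
have move1 a b : (forall j, al j = (j == a)%:R - (j == b)%:R) ->
    e a * mon (fun j => eta j + al j * (d - 1)) =
    e b * mon (fun j => eta j + al j * d).
  move=> alE; rewrite -!lmonS; apply: eq_mon => j.
  by rewrite /vadd alE; lia.
have alE j : al j = sgnd int i k * ((j == k)%:R - (j == i)%:R) by [].
clearbody al d; rewrite /qsign /sgnd in alE *.
have [ltik|ltki|/val_inj/eqP] := ltngtP i k; last by rewrite (negPf ik).
- rewrite ltik in alE; rewrite !mul1r.
  have [->|li] := eqVneq l i; last have [->|lk] := eqVneq l k.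
  + by rewrite (negPf ik) !subr0 gsumS mulrDr /= mulr1n mul1r.
  + rewrite !sub0r /= back mulrBr (move1 k i) ?mulN1r ?mulNr // => j.
    by rewrite alE mul1r.
  + by rewrite !subrr addr0 !mul0r addr0.
- have nik : (i < k)%N = false by lia.
  rewrite nik ltki in alE; rewrite !mulN1r.
  have [->|li] := eqVneq l i; last have [->|lk] := eqVneq l k.
  + rewrite (negPf ik) !subr0 /= mulr1n back mulrBr (move1 i k) => [|j].
      by rewrite mulrN opprB mul1r addrC.
    by rewrite alE mulN1r opprB.
  + by rewrite !sub0r /= mulr1n opprK gsumS mulrDr mulN1r opprD mulrN mulNr.
  + by rewrite !subrr oppr0 addr0 !mul0r addr0 mulrN.
Qed.

End LaurentMonomials.

(** * Rational versus trigonometric relations *)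

Section DunklCherednik.
Context (n : nat) (B : pzRingType) (w : B).
Hypothesis wC : forall a, w * a = a * w.
Local Notation br a b := (a * b - b * a).

Let wCA a b : a * (w * b) = w * (a * b).
Proof. by rewrite !mulrA wC. Qed.

Section RationalRelations.
Context (c : 'I_n -> B) (s : 'S_n -> B) (x y : 'I_n -> B).
Local Notation T := (exch c s).
Local Notation J := (jucys c s).

Record rational_action : Prop := RationalAction {
  ra_cs : sergeev_action c s;
  ra_x : x_like c s x;
  ra_y : y_like c s y;
  ra_xy : forall i l, br (x i) (y l) = w * \sum_(k | k != i) qsign B i k l * T i k
}.

Lemma qsign_sum_neq i l (F : 'I_n -> B) : i != l ->
  \sum_(k | k != i) qsign B i k l * F k = - F l.
Proof.
move=> il; rewrite (bigD1 l) 1?eq_sym //= /qsign [l == i]eq_sym (negPf il) eqxx.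
rewrite sub0r /= mulr1n mulN1r big1 ?addr0 // => k /andP[_ kl].
by rewrite [l == k]eq_sym (negPf kl) subr0 mul0r.
Qed.

Lemma qsign_sum_eq i (F : 'I_n -> B) :
  \sum_(k | k != i) qsign B i k i * F k = \sum_(k | k != i) F k.
Proof.
apply: eq_bigr => k ki.
by rewrite /qsign eqxx [i == k]eq_sym (negPf ki) subr0 /= mulr1n mul1r.
Qed.

(** The image of epsilon_i^vee in the localized rational algebra. *)
Definition cherednik i := y i * x i + w * J i.

Lemma y_like_mul_x_like : y_like c s y -> x_like c s x ->
  x_like c s (fun i => y i * x i).
Proof.
move=> yl xl; split=> [sigma i|i|i j ij].
- by rewrite mulrA (yl_s yl) -mulrA (xl_s xl) mulrA.
- by rewrite mulrA (yl_c yl) -mulrA (xl_c xl) mulrN mulrA.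
- by rewrite mulrA (yl_c yl) -mulrA (xl_c_neq xl ij) mulrA.
Qed.

Section Cherednik.
Hypothesis ra : rational_action.
Let cs := ra_cs ra.
Let xl := ra_x ra.
Let yl := ra_y ra.

Lemma rational_x_like_yx : x_like c s (fun i => y i * x i).
Proof. exact: y_like_mul_x_like. Qed.
Let pl := rational_x_like_yx.

(** The correction to the product of P_i = y_i x_i and P_j is - u P_i T_ji: the
    factor T_ij produced by [x_i, y_j] becomes T_ji when x_j is moved past it. *)
Lemma rational_yxyx i j : i != j ->
  y i * x i * (y j * x j) = y i * y j * (x i * x j) - w * (y i * x i * T j i).
Proof.
move=> ij; have := ra_xy ra i j; rewrite (qsign_sum_neq _ ij) mulrN => /eqP.
rewrite subr_eq addrC => /eqP E.
rewrite -mulrA (mulrA (x i)) E mulrBl mulrBr !mulrA; congr (_ - _).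
by rewrite -wC -!mulrA (exch_x cs xl ij).
Qed.

(** The terms of [y_i x_i, y_j x_j] coming from [x_i, y_j] and [y_i, x_j] cancel
    against u [y_i x_i, J_j].  The equation is used in both directions: to deduce
    that the D_i commute from the x_i doing so, and conversely. *)
Lemma cherednik_br (i j : 'I_n) : (i < j)%N ->
  br (cherednik i) (cherednik j) = y i * y j * br (x i) (x j).
Proof.
move=> ij; have ij' : i != j by rewrite -val_eqE /= ltn_eqF.
have ji' : j != i by rewrite eq_sym.
rewrite /cherednik brDl !brDr !(brZl _ _ wC) !(brZr _ _ wC).
rewrite (exch_jucys_comm cs pl ij) (jucys_x_comm pl ij) subrr mulr0 add0r.
rewrite (jucysC cs ij) subrr !mulr0 addr0.
rewrite (rational_yxyx ij') (rational_yxyx ji') (yl_y yl j i) !mulrBr.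
have cancel (p q a b : B) : p - a - (q - b) + (a - b) = p - q.
  by rewrite opprB [b - q]addrC [p - a + _]addrACA [- a + b]addrC -[b - a]opprB subrK.
exact: cancel.
Qed.

Lemma cherednik_c i : c i * cherednik i = - (cherednik i * c i).
Proof.
rewrite /cherednik mulrDr mulrDl (xl_c pl) wCA (jucys_c cs).
by rewrite mulrN opprD -(mulrA w).
Qed.

Lemma cherednik_c_neq i j : i != j -> c j * cherednik i = cherednik i * c j.
Proof.
move=> ij; rewrite /cherednik mulrDr mulrDl (xl_c_neq pl ij) wCA.
by rewrite (jucys_c_neq cs ij) mulrA.
Qed.

Lemma cherednik_adj (i i' : 'I_n) : i' = i.+1 :> nat ->
  cherednik i' * s (tperm i i') - s (tperm i i') * cherednik i =
  w * (1 - c i' * c i).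
Proof.
move=> ii'; rewrite -(jucys_adj cs ii') /cherednik mulrDl mulrDr (xl_s pl) tpermL.
by rewrite opprD addrACA subrr add0r mulrBr wCA -(mulrA w).
Qed.

Lemma cherednik_far (i i' j : 'I_n) : i' = i.+1 :> nat -> j != i -> j != i' ->
  cherednik j * s (tperm i i') = s (tperm i i') * cherednik j.
Proof.
move=> ii' ji ji'; rewrite /cherednik mulrDl mulrDr (xl_s pl) tpermD 1?eq_sym //.
by rewrite wCA -(mulrA w) (jucys_far cs ii' ji ji').
Qed.

End Cherednik.

Section ExchangeY.
Hypothesis yl : y_like c s y.

(** For k < i the summand of [J_i, y_l] replaces the coefficient y_i by y_k; this
    is how the order of the indices enters the trigonometric relations. *)
Lemma jucys_y i l : \sum_(k | k != i) qsign B i k l * y (if (i < k)%N then i else k) * T i k =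
  y i * (\sum_(k | k != i) qsign B i k l * T i k) + br (J i) (y l).
Proof.
rewrite !jucys_def mulr_sumr mulr_suml mulr_sumr -sumrB.
have -> : \sum_(k < n | (k < i)%N) (T i k * y l - y l * T i k) =
    \sum_(k | k != i) if (k < i)%N then T i k * y l - y l * T i k else 0.
  rewrite -big_mkcondr; apply: eq_bigl => k.
  by rewrite -val_eqE /=; case: ltngtP.
rewrite -big_split; apply: eq_bigr => k ki /=; rewrite mulrA.
have comm_q a : qsign B i k l * a = a * qsign B i k l.
  rewrite /qsign mulrBl mulrBr.
  by congr (_ - _); case: eqP => _; rewrite ?mul1r ?mulr1 ?mul0r ?mulr0.
rewrite -comm_q; have [ik|ki'|/val_inj ik] := ltngtP i k; first by rewrite addr0.
  rewrite exch_y // -mulrBl -mulrDl; congr (_ * _); rewrite /qsign.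
  have [->|li] := eqVneq l i; last have [->|lk] := eqVneq l k.
  - by rewrite tpermR [i == k]eq_sym (negPf ki) subr0 /= mulr1n !mul1r addrC subrK.
  - by rewrite tpermL sub0r /= mulr1n !mulN1r addrA addNr add0r.
  - by rewrite tpermD 1?eq_sym // !subrr !mul0r add0r.
by rewrite ik eqxx in ki.
Qed.

End ExchangeY.

Lemma cherednik_y (ra : rational_action) i l : br (cherednik i) (y l) =
  w * \sum_(k | k != i) qsign B i k l * y (if (i < k)%N then i else k) * T i k.
Proof.
have yl := ra_y ra.
rewrite (jucys_y yl) [RHS]mulrDr -wCA -(ra_xy ra).
rewrite /cherednik brDl (brZl _ _ wC); congr (_ + _).
by rewrite mulrBr !mulrA (yl_y yl l i).
Qed.

End RationalRelations.

Section TrigonometricRelations.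
Context (c : 'I_n -> B) (s : 'S_n -> B) (e e' d : 'I_n -> B).
Local Notation T := (exch c s).
Local Notation J := (jucys c s).

Record trigonometric_action : Prop := TrigonometricAction {
  ta_cs : sergeev_action c s;
  ta_e : y_like c s e;
  ta_eV : forall i, e i * e' i = 1;
  ta_Ve : forall i, e' i * e i = 1;
  ta_dd : forall i j, d i * d j = d j * d i;
  ta_c : forall i, c i * d i = - (d i * c i);
  ta_c_neq : forall i j, i != j -> c j * d i = d i * c j;
  ta_adj : forall i i' : 'I_n, i' = i.+1 :> nat ->
    d i' * s (tperm i i') - s (tperm i i') * d i = w * (1 - c i' * c i);
  ta_far : forall i i' j : 'I_n, i' = i.+1 :> nat -> j != i -> j != i' ->
    d j * s (tperm i i') = s (tperm i i') * d j;
  ta_de : forall i eta, br (d i) (lmon e e' eta) =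
    w * \sum_(k | k != i) squot e e' i k eta * T i k
}.

End TrigonometricRelations.

(** The commutator with e^eta is obtained from [cherednik_y] by adding one
    coordinate vector to eta at a time. *)
Lemma rational_to_trigonometric c s x y y' : rational_action c s x y ->
    (forall i j, x i * x j = x j * x i) ->
    (forall i, y i * y' i = 1) -> (forall i, y' i * y i = 1) ->
  trigonometric_action c s y y' (cherednik c s x y).
Proof.
move=> ra xx yV Vy; have [cs xl yl _] := ra; have yy := yl_y yl.
split=> //.
- have lt_comm (i j : 'I_n) : (i < j)%N ->
      cherednik c s x y i * cherednik c s x y j =
      cherednik c s x y j * cherednik c s x y i.
    by move=> ij; apply/eqP; rewrite -subr_eq0 (cherednik_br ra ij) xx subrr mulr0.
  move=> i j; have [/lt_comm//|/lt_comm//|/val_inj->//] := ltngtP i j.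
- exact: cherednik_c ra.
- exact: cherednik_c_neq ra.
- exact: cherednik_adj ra.
- exact: cherednik_far ra.
move=> i; elim/int_vec_ind => [|eta l].
  rewrite lmon0 mulr1 mul1r subrr big1 ?mulr0 // => k _.
  by rewrite squot0 mul0r.
rewrite lmonS // brMr (cherednik_y ra).
set R := \sum_(k | k != i) squot y y' i k eta * exch c s i k.
have -> : \sum_(k | k != i) squot y y' i k (vadd eta l) * exch c s i k =
    (\sum_(k | k != i) qsign B i k l * y (if (i < k)%N then i else k)
       * exch c s i k) * lmon y y' eta + y l * R.
  rewrite mulr_suml mulr_sumr -big_split; apply: eq_bigr => k ki /=.
  have Ty j : exch c s i k * y j = y (tperm k i j) * exch c s i k.
    by rewrite (exch_y _ _ _ yl).
  have := lmon_exch yV Vy yy Ty (fun j => eta (tperm k i j)) => /=.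
  rewrite (@eq_mon _ _ _ _ _ eta) => [Tm|j]; last by rewrite tpermK.
  by rewrite squotS 1?eq_sym // mulrDl addrC -!mulrA Tm.
rewrite [w * (_ + _)]mulrDr (mulrA w _ (lmon _ _ _)) -(wCA (y l)); split=> [->//|/addrI E].
by rewrite -[LHS]mul1r -(Vy l) -mulrA E mulrA Vy mul1r.
Qed.

(** Equivariance passes to products of permutations, hence from the adjacent
    transpositions to all transpositions (by induction on the distance) and to the
    whole group. *)
Lemma equivariant_adj (s : 'S_n -> B) (p : 'I_n -> B) :
    s 1%g = 1 -> (forall sigma tau, s sigma * s tau = s (tau * sigma)%g) ->
    (forall i i' : 'I_n, i' = i.+1 :> nat ->
       p i' * s (tperm i i') = s (tperm i i') * p i) ->
    (forall i i' j : 'I_n, i' = i.+1 :> nat -> j != i -> j != i' ->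
       p j * s (tperm i i') = s (tperm i i') * p j) ->
  forall sigma i, s sigma * p i = p (sigma i) * s sigma.
Proof.
move=> s1 sM adj far; pose eqv sigma := forall i, s sigma * p i = p (sigma i) * s sigma.
have eqvM sigma tau : eqv sigma -> eqv tau -> eqv (sigma * tau)%g.
  by move=> Es Et i; rewrite -sM -mulrA Es mulrA Et permM mulrA.
have eqv_adj (i i' : 'I_n) : i' = i.+1 :> nat -> eqv (tperm i i').
  move=> ii' j; have [->|ji] := eqVneq j i; first by rewrite tpermL adj.
  have [->|ji'] := eqVneq j i'; last by rewrite tpermD 1?eq_sym // far.
  rewrite tpermR -[LHS]mulr1 -[X in _ * X]s1 -(tperm2 i i') -sM !mulrA.
  by rewrite -(mulrA _ (p i')) adj // !mulrA sM tperm2 s1 mul1r.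
have eqv_tperm m : forall i j : 'I_n, j = (i + m)%N :> nat -> eqv (tperm i j).
  elim: m => [|m IHm] i j ij.
    have -> : j = i by apply: val_inj; rewrite /= ij addn0.
    by rewrite tperm1 => l; rewrite s1 mul1r mulr1 perm1.
  have [m0|m_gt0] := posnP m; first by apply: eqv_adj; rewrite ij m0 addn1.
  have ltk : (i + m < n)%N by have := ltn_ord j; lia.
  pose k := Ordinal ltk; have kj : j = k.+1 :> nat by rewrite ij addnS.
  have ki : k != i by rewrite -val_eqE /=; lia.
  have ji : j != i by rewrite -val_eqE /=; lia.
  (* s_ij is conjugate to s_ik by the adjacent transposition s_kj. *)
  have <- : (tperm k j * tperm i k * tperm k j)%g = tperm i j.
    by rewrite -{1}(tpermV k j) -mulgA -conjgE tpermJ tpermL tpermD.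
  by apply: (eqvM); [apply: (eqvM)|]; [exact: eqv_adj|exact: IHm|exact: eqv_adj].
move=> sigma; have [ts -> _] := prod_tpermP sigma.
elim: ts => [|t ts IHts]; first by move=> i; rewrite big_nil s1 mul1r mulr1 perm1.
rewrite big_cons; apply: eqvM IHts; case: t => i j /=.
have [ij|ji] := leqP i j; first by apply: (eqv_tperm (j - i)%N); lia.
by rewrite tpermC; apply: (eqv_tperm (i - j)%N); lia.
Qed.

(** The elements p_i = d_i - w J_i play the role of y_i x_i: subtracting w J_i
    makes the relations with S_n homogeneous. *)
Lemma trigonometric_to_rational c s e e' d
    (x := fun i => e' i * (d i - w * jucys c s i)) :
  trigonometric_action c s e e' d ->
  [/\ rational_action c s x e, forall i j, x i * x j = x j * x i
    & d =1 cherednik c s x e].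
Proof.
case=> cs el eV Ve dd dc dcn dadj dfar de; have ee := yl_y el.
pose p i := d i - w * jucys c s i.
have exE i : e i * x i = p i by rewrite mulrA eV mul1r.
have dE : d =1 cherednik c s x e by move=> i; rewrite /cherednik exE subrK.
have e'l : y_like c s e'.
  split=> [sigma i|i j|i j].
  - rewrite -[RHS]mulr1 -(eV i) !mulrA -(mulrA _ _ (e i)) (yl_s el).
    by rewrite !mulrA Ve mul1r.
  - by apply/esym/(inv_commutes (eV i) (Ve i)); rewrite (yl_c el).
  - apply: (inv_commutes (eV i) (Ve i)).
    by apply/esym/(inv_commutes (eV j) (Ve j)); rewrite ee.
have pE a b t : p a * t - t * p b =
    d a * t - t * d b - w * (jucys c s a * t - t * jucys c s b).
  rewrite /p mulrBl mulrBr wCA -(mulrA w) [w * (_ - _)]mulrBr !opprB.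
  by rewrite [_ - t * d b]addrC addrACA [- _ + _]addrC.
have pl : x_like c s p.
  split=> [|i|i j ij].
  - apply: equivariant_adj (sgv_s1 cs) (sgv_sM cs) _ _ => [i i' ii'|i i' j ii' ji ji'].
      by apply/eqP; rewrite -subr_eq0 pE dadj // (jucys_adj cs ii') subrr.
    apply/eqP; rewrite -subr_eq0 pE dfar // (jucys_far cs ii' ji ji').
    by rewrite !subrr mulr0 subr0.
  - by rewrite /p mulrBl mulrBr wCA dc (jucys_c cs) -(mulrA w) mulrN opprB opprK addrC.
  - by rewrite /p mulrBl mulrBr wCA dcn // (jucys_c_neq cs ij) -(mulrA w).
have xl : x_like c s x by exact: y_like_mul_x_like e'l pl.
have ra : rational_action c s x e.
  split=> // i l; have := de i (vadd (fun=> 0) l).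
  rewrite lmonS // lmon0 mulr1 => dE'.
  have brp : p i * e l - e l * p i = w * (e i * \sum_(k | k != i) qsign B i k l * exch c s i k).
    rewrite pE dE'.
    rewrite -mulrBr; congr (w * _); apply/eqP; rewrite subr_eq; apply/eqP.
    rewrite -(jucys_y el); apply: eq_bigr => k ki.
    by rewrite squotS 1?eq_sym // squot0 mulr0 add0r lmon0 mulr1.
  rewrite /x -/(p i) [e l * _]mulrA -(inv_commutes (eV i) (Ve i) (ee i l)).
  by rewrite -!mulrA -mulrBr brp wCA (mulrA (e' i)) Ve mul1r.
split=> //.
have lt_comm (i j : 'I_n) : (i < j)%N -> x i * x j = x j * x i.
  move=> ij; have := cherednik_br ra ij; rewrite -!dE dd subrr => /esym E.
  have cancel z : e i * e j * z = 0 -> z = 0.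
    by move=> E0; rewrite -[z]mul1r -(Ve j) -[e j]mul1r -(Ve i) -!mulrA (mulrA (e i)) E0 !mulr0.
  by apply/eqP; rewrite -subr_eq0; apply/eqP/cancel.
by move=> i j; have [/lt_comm//|/lt_comm//|/val_inj->//] := ltngtP i j.
Qed.

End DunklCherednik.

(** * Homomorphisms out of the two algebras *)

Section LaurentMorphism.
Context (n : nat) (A B : pzRingType) (f : {rmorphism A -> B}).
Context (e e' : 'I_n -> A).

Lemma rmorph_lmon eta :
  f (lmon e e' eta) = lmon (fun i => f (e i)) (fun i => f (e' i)) eta.
Proof.
rewrite /lmon rmorph_prod; apply: eq_bigr => j _.
by case: (eta j) => p /=; rewrite rmorphXn.
Qed.

Lemma rmorph_squot i k eta :
  f (squot e e' i k eta) = squot (fun i => f (e i)) (fun i => f (e' i)) i k eta.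
Proof.
rewrite /squot rmorphM; congr (_ * _).
  by rewrite /sgnd; case: ifP => _; [|case: ifP => _];
     rewrite ?rmorph1 ?rmorphN1 ?rmorph0.
rewrite /lquot; case: (sgnd int i k * _) => d; rewrite ?rmorphN rmorph_sum;
  [|congr (- _)]; by apply: eq_bigr => t _; rewrite rmorph_lmon.
Qed.

End LaurentMorphism.

Section PresentationMorphisms.
Context (K : fieldType) (X : choiceType) (R : freeAlg K X -> freeAlg K X -> Prop).

Lemma pres_word (f : freeAlg K X) : pi_pres R f = \sum_(v <- fsupp f)
  scal (fcoef v f) * \prod_(x <- fmonom_val v) pgen R x.
Proof.
rewrite {1}(Defs.freeE f) pi_pres_sum; apply: eq_bigr => v _.
rewrite pi_presM; congr (_ * _).
elim: (fmonom_val v) => [|x r IHr]; first by rewrite !big_nil pi_pres1.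
by rewrite !big_cons pi_presM IHr.
Qed.

(** The scalars must be compared separately because ring morphisms need not be
    K-linear. *)
Lemma pres_hom_ext (B : pzRingType) (f g : {rmorphism pres R -> B}) :
  (forall k, f (scal k) = g (scal k)) ->
  (forall x, f (pgen R x) = g (pgen R x)) -> f =1 g.
Proof.
move=> fgK fgX a; have [h ->] := pi_pres_surj a.
rewrite pres_word !rmorph_sum; apply: eq_bigr => v _.
rewrite !rmorphM fgK; congr (_ * _).
by rewrite !rmorph_prod; apply: eq_bigr => x _.
Qed.

Lemma pres_ind (P : pres R -> Prop) :
  P 0 -> (forall a b, P a -> P b -> P (a + b)) ->
  (forall k, P (scal k)) -> (forall k a, P a -> P (scal k * a)) ->
  (forall x a, P a -> P (pgen R x * a)) -> forall a, P a.
Proof.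
move=> P0 PD PK PZ PX a; have [f ->] := pi_pres_surj a.
rewrite pres_word; elim/big_rec: _ => // v b _ Pb; apply: PD => //; apply: PZ.
elim: (fmonom_val v) => [|x r IHr]; first by rewrite big_nil -scal1; apply: PK.
by rewrite big_cons; apply: PX.
Qed.

End PresentationMorphisms.

Section RationalPresentation.
Context (K : fieldType) (n : nat) (u : K).

Lemma rdaha_action :
  rational_action (scal u) (@rc K n u) (@rs K n u) (@rx K n u) (@ry K n u) /\
  forall i j : 'I_n, rx u i * rx u j = rx u j * rx u i.
Proof.
have comm := pgen_rel_comm; have anti := pgen_rel_anti.
have cs : sergeev_action (@rc K n u) (@rs K n u).
  split=> [|sigma tau|sigma i|i|i j ij].
  - exact: (pi_pres_rel (rdaha_s1 n u)).
  - by apply: pgen_rel_mul; apply: rdaha_sM.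
  - by apply: comm; apply: rdaha_sc.
  - by rewrite -expr2; apply: pgen_rel_sq; apply: rdaha_c2.
  - by apply: anti; apply: rdaha_cc.
split; last by move=> i j; apply: comm; apply: rdaha_xx.
split=> //.
- split=> [sigma i|i|i j ij].
  + by apply: comm; apply: rdaha_sx.
  + by apply: anti; apply: rdaha_cx.
  + by apply: comm; apply: rdaha_cx_neq.
- split=> [sigma i|i j|i j].
  + by apply: comm; apply: rdaha_sy.
  + by have [<-|ij] := eqVneq i j; apply: comm; [apply: rdaha_cy|apply: rdaha_cy_neq].
  + by apply: comm; apply: rdaha_yy.
move=> i l; rewrite -[LHS]opprK opprB.
have [<-|il] := eqVneq i l.
  have := pi_pres_rel (rdaha_yx u i); rewrite pi_presB pi_presN !pi_presM pi_pres_sum => ->.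
  rewrite opprK qsign_sum_eq; congr (_ * _); apply: eq_bigr => k _.
  by rewrite exch_def pi_presM pi_presD pi_presM pi_pres1.
have := pi_pres_rel (rdaha_yx_neq u il); rewrite pi_presB !pi_presM => ->.
rewrite (qsign_sum_neq _ il) mulrN exch_def pi_presD pi_presM pi_pres1 tpermC.
by rewrite -mulrA.
Qed.

Context (B : assocAlgType K) (c : 'I_n -> B) (s : 'S_n -> B) (x y : 'I_n -> B).

Definition rgen_map (g : rgen n) : B :=
  match g with RX i => x i | RY i => y i | RC i => c i | RS sigma => s sigma end.

Lemma rational_lift : rational_action (scal u) c s x y ->
    (forall i j, x i * x j = x j * x i) ->
  forall l r, rdaha_rel u l r -> feval rgen_map l = feval rgen_map r.
Proof.
move=> [cs xl yl xy] xx l r.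
case=> [|sigma tau|i j|i j|sigma i|sigma i|sigma i|i|i|i j ij|i j ij|i|i j ij|i j ij|i];
  rewrite ?fevalXgen ?fevalN ?fevalMgen ?feval_gen ?feval1 //=.
- exact: sgv_s1 cs.
- exact: sgv_sM cs _ _.
- exact: yl_y yl _ _.
- exact: xl_s xl _ _.
- exact: yl_s yl _ _.
- exact: sgv_sc cs _ _.
- exact: xl_c xl _.
- exact: yl_c yl _ _.
- by rewrite (xl_c_neq xl ij).
- exact: yl_c yl _ _.
- by rewrite expr2; exact: sgv_c2 cs _.
- by rewrite (sgv_cc cs ij).
- have := xy i j; rewrite (qsign_sum_neq _ ij) mulrN => /(congr1 -%R).
  rewrite opprB opprK rmorphB /= !fevalMgen /= => ->.
  by rewrite !fevalM feval_scal fevalD feval1 !fevalM !feval_gen /= exch_def tpermC mulrA.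
- have := xy i i; rewrite qsign_sum_eq => /(congr1 -%R).
  rewrite opprB rmorphB /= !fevalMgen /= => ->.
  rewrite fevalM feval_scal raddf_sum; congr (- (_ * _)); apply: eq_bigr => k _.
  by rewrite /= !fevalM fevalD feval1 !fevalM !feval_gen /= exch_def.
Qed.

End RationalPresentation.

Section TrigonometricPresentation.
Context (K : fieldType) (n : nat) (u : K).

Lemma tdaha_action :
  trigonometric_action (scal u) (@tc K n u) (@ts K n u) (@te K n u) (@teV K n u) (@td K n u).
Proof.
have comm := pgen_rel_comm; have anti := pgen_rel_anti.
have cs : sergeev_action (@tc K n u) (@ts K n u).
  split=> [|sigma tau|sigma i|i|i j ij].
  - exact: (pi_pres_rel (tdaha_s1 n u)).
  - by apply: pgen_rel_mul; apply: tdaha_sM.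
  - by apply: comm; apply: tdaha_sc.
  - by rewrite -expr2; apply: pgen_rel_sq; apply: tdaha_c2.
  - by apply: anti; apply: tdaha_cc.
split=> //.
- split=> [sigma i|i j|i j].
  + by apply: comm; apply: tdaha_se.
  + by apply: comm; apply: tdaha_ce.
  + by apply: comm; apply: tdaha_ee.
- by move=> i; have := pi_pres_rel (tdaha_eeV u i); rewrite pi_presM pi_pres1.
- by move=> i; have := pi_pres_rel (tdaha_eVe u i); rewrite pi_presM pi_pres1.
- by move=> i j; apply: comm; apply: tdaha_dd.
- by move=> i; apply: anti; apply: tdaha_cd.
- by move=> i j ij; apply: comm; apply: tdaha_cd_neq.
- move=> i i' ii'; have := pi_pres_rel (tdaha_ds u ii').
  by rewrite pi_presB !pi_presM pi_presB pi_pres1 pi_presM.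
- by move=> i i' j ii' ji ji'; apply: comm; apply: tdaha_ds_neq.
move=> i eta; have := pi_pres_rel (tdaha_de u i eta).
rewrite pi_presB !pi_presM pi_pres_sum rmorph_lmon => ->; congr (_ * _).
apply: eq_bigr => k ki.
rewrite pi_presM pi_presM pi_presB pi_pres1 [pi_pres _ (fgen _ _ * _)]pi_presM.
rewrite (exchE cs) 1?eq_sym // mulrA; congr (_ * _ * _).
exact: rmorph_squot.
Qed.

Context (B : assocAlgType K) (c : 'I_n -> B) (s : 'S_n -> B).
Context (e e' d : 'I_n -> B).

Definition tgen_map (g : tgen n) : B :=
  match g with
  | TE i => e i | TEV i => e' i | TD i => d i | TC i => c i | TS sigma => s sigma
  end.

Lemma trigonometric_lift : trigonometric_action (scal u) c s e e' d ->
  forall l r, tdaha_rel u l r -> feval tgen_map l = feval tgen_map r.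
Proof.
move=> [cs el eV Ve dd dc dcn dadj dfar de] l r.
case=> [|sigma tau|i|i j ij|i|i|i j|i j|i j|sigma i|sigma i|i|i j ij|i i' ii'|i i' j ii' ji ji'|i eta];
  rewrite ?fevalXgen ?fevalN ?fevalMgen ?feval_gen ?feval1 //=.
- exact: sgv_s1 cs.
- exact: sgv_sM cs _ _.
- by rewrite expr2; exact: sgv_c2 cs _.
- by rewrite (sgv_cc cs ij).
- exact: yl_y el _ _.
- exact: yl_c el _ _.
- exact: yl_s el _ _.
- exact: sgv_sc cs _ _.
- by rewrite dcn.
- by rewrite rmorphB fevalM feval_scal rmorphB /= !fevalMgen feval1 /= dadj.
- by rewrite dfar.
rewrite rmorphB /= !fevalM feval_scal feval_gen rmorph_lmon /= raddf_sum.
have fe (f g : 'I_n -> freeAlg K (tgen n)) f' g' z :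
    (forall j, feval tgen_map (f j) = f' j) -> (forall j, feval tgen_map (g j) = g' j) ->
    lmon (fun j => feval tgen_map (f j)) (fun j => feval tgen_map (g j)) z = lmon f' g' z.
  by move=> /funext -> /funext ->.
rewrite (fe _ _ e e') => [|j|j]; rewrite ?feval_gen // de; congr (_ * _).
apply: eq_bigr => k ki; rewrite /= fevalM fevalM rmorphB /= fevalMgen feval1 feval_gen /=.
rewrite (exchE cs) 1?eq_sym // mulrA; congr (_ * _ * _).
have := rmorph_squot (feval tgen_map) (fun j => fgen K (TE j)) (fun j => fgen K (TEV j)) i k eta.
rewrite /squot => /= ->.
have -> : (fun i : 'I_n => feval tgen_map (fgen K (TE i))) = e.
  by apply/funext => j; rewrite feval_gen.
have -> // : (fun i : 'I_n => feval tgen_map (fgen K (TEV i))) = e'.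
by apply/funext => j; rewrite feval_gen.
Qed.

End TrigonometricPresentation.

(** * Linear endomorphisms and finitely supported functions *)

Section LinearEndomorphisms.
Context (K : fieldType) (V : lmodType K).

(** Linear endomorphisms of a module of arbitrary dimension, made into a K-algebra
    so that a presented algebra can be mapped to it. *)
Record lendo : Type := Lendo { lendo_fun :> V -> V; lendoP : linear lendo_fun }.

HB.instance Definition _ := gen_eqMixin lendo.
HB.instance Definition _ := gen_choiceMixin lendo.

Lemma lendo_eqP (f g : lendo) : f =1 g -> f = g.
Proof.
case: f g => [f fP] [g gP] /= /funext E; rewrite E in fP *.
by congr Lendo; apply: Prop_irrelevance.
Qed.

HB.instance Definition _ (f : lendo) :=
  GRing.isLinear.Build K V V *:%R f (lendoP f).

Fact lendo_add_linear (f g : lendo) : linear (fun v => f v + g v).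
Proof. by move=> k v v'; rewrite !linearP scalerDr addrACA. Qed.
Fact lendo_opp_linear (f : lendo) : linear (fun v => - f v).
Proof. by move=> k v v'; rewrite linearP opprD scalerN. Qed.
Fact lendo_zero_linear : linear (fun _ : V => 0 : V).
Proof. by move=> k v v'; rewrite scaler0 addr0. Qed.
Fact lendo_mul_linear (f g : lendo) : linear (fun v => f (g v)).
Proof. by move=> k v v'; rewrite !linearP. Qed.
Fact lendo_scal_linear (k : K) : linear (fun v : V => k *: v).
Proof. by move=> l v v'; rewrite scalerDr !scalerA mulrC. Qed.

Definition lendo_add f g := Lendo (lendo_add_linear f g).
Definition lendo_opp f := Lendo (lendo_opp_linear f).
Definition lendo_zero := Lendo lendo_zero_linear.
Definition lendo_mul f g := Lendo (lendo_mul_linear f g).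
Definition lendo_scal k := Lendo (lendo_scal_linear k).

Fact lendo_addA : associative lendo_add.
Proof. by move=> f g h; apply: lendo_eqP => v /=; rewrite addrA. Qed.
Fact lendo_addC : commutative lendo_add.
Proof. by move=> f g; apply: lendo_eqP => v /=; rewrite addrC. Qed.
Fact lendo_add0 : left_id lendo_zero lendo_add.
Proof. by move=> f; apply: lendo_eqP => v /=; rewrite add0r. Qed.
Fact lendo_addN : left_inverse lendo_zero lendo_opp lendo_add.
Proof. by move=> f; apply: lendo_eqP => v /=; rewrite addNr. Qed.
Fact lendo_mulA : associative lendo_mul.
Proof. by move=> f g h; apply: lendo_eqP. Qed.
Fact lendo_mul1 : left_id (lendo_scal 1) lendo_mul.
Proof. by move=> f; apply: lendo_eqP => v /=; rewrite scale1r. Qed.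
Fact lendo_mulr1 : right_id (lendo_scal 1) lendo_mul.
Proof. by move=> f; apply: lendo_eqP => v /=; rewrite scale1r. Qed.
Fact lendo_mulDl : left_distributive lendo_mul lendo_add.
Proof. by move=> f g h; apply: lendo_eqP. Qed.
Fact lendo_mulDr : right_distributive lendo_mul lendo_add.
Proof. by move=> f g h; apply: lendo_eqP => v /=; rewrite linearD. Qed.

HB.instance Definition _ :=
  GRing.isZmodule.Build lendo lendo_addA lendo_addC lendo_add0 lendo_addN.
HB.instance Definition _ := GRing.Zmodule_isPzRing.Build lendo
  lendo_mulA lendo_mul1 lendo_mulr1 lendo_mulDl lendo_mulDr.

Lemma lendoDE (f g : lendo) v : (f + g) v = f v + g v. Proof. by []. Qed.
Lemma lendoNE (f : lendo) v : (- f) v = - f v. Proof. by []. Qed.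
Lemma lendo0E v : (0 : lendo) v = 0. Proof. by []. Qed.
Lemma lendo1E v : (1 : lendo) v = v. Proof. exact: scale1r. Qed.
Lemma lendoME (f g : lendo) v : (f * g) v = f (g v). Proof. by []. Qed.
Lemma lendo_sumE (I : Type) (r : seq I) (P : pred I) (F : I -> lendo) v :
  (\sum_(i <- r | P i) F i) v = \sum_(i <- r | P i) F i v.
Proof. exact: (big_morph (fun f : lendo => f v) (fun f g => lendoDE f g v) (lendo0E v)). Qed.

Fact lendo_scal1 : lendo_scal 1 = 1. Proof. by []. Qed.
Fact lendo_scalB k l : lendo_scal (k - l) = lendo_scal k - lendo_scal l.
Proof. by apply: lendo_eqP => v; rewrite lendoDE lendoNE /= scalerBl. Qed.
Fact lendo_scalM k l : lendo_scal (k * l) = lendo_scal k * lendo_scal l.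
Proof. by apply: lendo_eqP => v; rewrite lendoME /= scalerA. Qed.
Fact lendo_scal_comm k (f : lendo) : lendo_scal k * f = f * lendo_scal k.
Proof. by apply: lendo_eqP => v; rewrite !lendoME /= linearZ. Qed.

HB.instance Definition _ := isAssocAlg.Build K lendo
  lendo_scal1 lendo_scalB lendo_scalM lendo_scal_comm.

Lemma lendo_scalE k v : (scal k : lendo) v = k *: v. Proof. by []. Qed.

End LinearEndomorphisms.
#[global] Arguments lendo_fun : simpl never.

(** The additive extension of the maps F b, defined on the functions supported at
    b, to all finitely supported functions. *)
HB.lock Definition malg_ext (E : choiceType) (G W : zmodType) (F : E -> G -> W)
  (m : {malg G[E]}) : W := \sum_(b <- msupp m) F b (mcoeff b m).
Arguments malg_ext {E G W} F m.

Section FiniteSupport.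
Context (E : choiceType) (G W : zmodType).

Lemma malg_additive_ext (f g : {malg G[E]} -> W) :
  zmod_morphism f -> zmod_morphism g ->
  (forall b h, f << h *g b >> = g << h *g b >>) -> f =1 g.
Proof.
move=> fz gz fg m.
pose fA : {additive _ -> _} := HB.pack f (GRing.isZmodMorphism.Build _ _ f fz).
pose gA : {additive _ -> _} := HB.pack g (GRing.isZmodMorphism.Build _ _ g gz).
rewrite (monalgE m) -[LHS]/(fA _) -[RHS]/(gA _) !raddf_sum.
by apply: eq_bigr => b _; apply: fg.
Qed.

Context (F : E -> G -> W) (FB : forall b, zmod_morphism (F b)).

Let F0 b : F b 0 = 0.
Proof. by rewrite -[0](subrr 0) FB subrr. Qed.

Lemma malg_extEw (d : {fset E}) m : (msupp m `<=` d)%fset ->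
  malg_ext F m = \sum_(b <- d) F b (mcoeff b m).
Proof.
move=> le; rewrite malg_ext.unlock [LHS](big_fset_incl _ le) => //= b bd bm.
by rewrite mcoeff_outdom.
Qed.

Lemma malg_extU b h : malg_ext F << h *g b >> = F b h.
Proof. by rewrite (malg_extEw msuppU_le) big_seq_fset1 mcoeffUU. Qed.

Lemma malg_ext_zmod : zmod_morphism (malg_ext F).
Proof.
move=> m1 m2; rewrite (malg_extEw (msuppB_le m1 m2)).
rewrite (malg_extEw (fsubsetUl (msupp m1) (msupp m2))).
rewrite (malg_extEw (fsubsetUr (msupp m1) (msupp m2))) -sumrB.
by apply: eq_bigr => b _; rewrite mcoeffB FB.
Qed.

End FiniteSupport.

(** * The module of polynomials in the y_i *)

Section Exponents.
Context (n : nat).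
Local Notation E := {ffun 'I_n -> nat}.

Definition expS (b : E) (l : 'I_n) : E := [ffun j => b j + (j == l)]%N.
Definition exp_perm (sigma : 'S_n) (b : E) : E := [ffun j => b (sigma^-1%g j)].
(** Replaces the exponents at i and k. *)
Definition exp_set (b : E) (i : 'I_n) (p : nat) (k : 'I_n) (q : nat) : E :=
  [ffun j => if j == i then p else if j == k then q else b j].
Definition exp0 : E := [ffun=> 0%N].

Lemma exp_ind (P : E -> Prop) :
  P exp0 -> (forall b l, P b -> P (expS b l)) -> forall b, P b.
Proof.
move=> P0 PS b; have [m] := ubnP (\sum_j b j); elim: m b => // m IHm b le_m.
have [/forallP b0|] := boolP [forall j, b j == 0%N].
  by suff -> : b = exp0 by []; apply/ffunP => j; rewrite ffunE; apply/eqP.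
rewrite negb_forall => /existsP[l bl]; pose b' : E := [ffun j => b j - (j == l)]%N.
have Eb : b = expS b' l.
  apply/ffunP => j; rewrite !ffunE; case: eqP => [->|_]; last by rewrite subn0 addn0.
  by rewrite subnK // lt0n.
rewrite Eb; apply/PS/IHm; rewrite -ltnS; apply: leq_trans le_m.
rewrite ltnS [X in (_ < X)%N](bigD1 l) // [X in (X < _)%N](bigD1 l) //= ffunE eqxx.
rewrite -addSn subn1 prednK ?lt0n // leq_add2l; apply: leq_sum => j _.
by rewrite ffunE leq_subr.
Qed.

Lemma expSC b l l' : expS (expS b l) l' = expS (expS b l') l.
Proof. by apply/ffunP => j; rewrite !ffunE addnAC. Qed.

Lemma expS_inj l : injective (fun b => expS b l).
Proof. by move=> b b' /ffunP E; apply/ffunP => j; have := E j; rewrite !ffunE => /addIn. Qed.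

Lemma exp_perm1 b : exp_perm 1 b = b.
Proof. by apply/ffunP => j; rewrite ffunE invg1 perm1. Qed.

Lemma exp_permM sigma tau b :
  exp_perm sigma (exp_perm tau b) = exp_perm (tau * sigma) b.
Proof. by apply/ffunP => j; rewrite !ffunE invMg permM. Qed.

Lemma exp_permS sigma b l : exp_perm sigma (expS b l) = expS (exp_perm sigma b) (sigma l).
Proof.
apply/ffunP => j; rewrite !ffunE; congr (_ + nat_of_bool _)%N.
by apply/eqP/eqP => [<-|->]; rewrite ?permKV ?permK.
Qed.

Lemma exp_perm_set sigma b i p k q : exp_perm sigma (exp_set b i p k q) =
  exp_set (exp_perm sigma b) (sigma i) p (sigma k) q.
Proof.
apply/ffunP => j; rewrite !ffunE.
have perm_eqE l : (sigma^-1%g j == l) = (j == sigma l).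
  by apply/eqP/eqP => [<-|->]; rewrite ?permKV ?permK.
by rewrite !perm_eqE.
Qed.

End Exponents.

(** Polynomials in commuting variables Y_1, ..., Y_n with coefficients in A,
    written on the right of the monomials. *)
Definition ypoly (n : nat) (A : zmodType) : Type := {malg A[{ffun 'I_n -> nat}]}.
HB.instance Definition _ n A := GRing.Zmodule.on (ypoly n A).

Section PolynomialModule.
Context (K : fieldType) (n : nat) (A : assocAlgType K).
Local Notation E := {ffun 'I_n -> nat}.
Local Notation M := (ypoly n A).

Definition ymon (b : E) (h : A) : M := << h *g b >>.
Definition ycoef (b : E) (m : M) : A := mcoeff b m.

Lemma ymonB b h h' : ymon b (h - h') = ymon b h - ymon b h'.
Proof. exact: monalgUB. Qed.
Lemma ymonD b h h' : ymon b (h + h') = ymon b h + ymon b h'.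
Proof. exact: monalgUD. Qed.
Lemma ymonN b h : ymon b (- h) = - ymon b h.
Proof. exact: monalgUN. Qed.
Lemma ymon0 b : ymon b 0 = 0.
Proof. exact: monalgU0. Qed.
Lemma ycoefB b m m' : ycoef b (m - m') = ycoef b m - ycoef b m'.
Proof. exact: mcoeffB. Qed.
Lemma ycoef_ymon b h b' : ycoef b' (ymon b h) = h *+ (b == b').
Proof. exact: mcoeffU. Qed.

Lemma ypoly_ext (W : zmodType) (f g : M -> W) :
  zmod_morphism f -> zmod_morphism g ->
  (forall b h, f (ymon b h) = g (ymon b h)) -> f =1 g.
Proof. exact: malg_additive_ext. Qed.

Definition ypoly_scale (k : K) : M -> M :=
  malg_ext (fun b h => ymon b (scal k * h)).

Fact ypoly_scale_zmod k : zmod_morphism (ypoly_scale k).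
Proof. by apply: malg_ext_zmod => b h h'; rewrite mulrBr ymonB. Qed.

Lemma ypoly_scale_mon k b h : ypoly_scale k (ymon b h) = ymon b (scal k * h).
Proof. by apply: malg_extU => b' h1 h2; rewrite mulrBr ymonB. Qed.

Fact ypoly_scaleA k l m : ypoly_scale k (ypoly_scale l m) = ypoly_scale (k * l) m.
Proof.
apply: (ypoly_ext (f := fun m => ypoly_scale k (ypoly_scale l m)) (g := ypoly_scale (k * l))).
- by move=> m1 m2; rewrite !ypoly_scale_zmod.
- exact: ypoly_scale_zmod.
- by move=> b h; rewrite !ypoly_scale_mon scalM mulrA.
Qed.

Fact ypoly_scale1 : left_id 1 ypoly_scale.
Proof.
apply: (ypoly_ext (f := ypoly_scale 1) (g := id)) => [||b h].
- exact: ypoly_scale_zmod.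
- by [].
- by rewrite ypoly_scale_mon scal1 mul1r.
Qed.

Fact ypoly_scaleDr : right_distributive ypoly_scale +%R.
Proof.
move=> k m m'.
pose f : {additive M -> M} :=
  HB.pack (ypoly_scale k) (GRing.isZmodMorphism.Build _ _ _ (ypoly_scale_zmod k)).
exact: (raddfD f).
Qed.

Fact ypoly_scaleDl m : {morph ypoly_scale^~ m : k l / k + l}.
Proof.
move=> k l; apply: (ypoly_ext (f := ypoly_scale (k + l))
  (g := fun m => ypoly_scale k m + ypoly_scale l m)).
- exact: ypoly_scale_zmod.
- by move=> m1 m2; rewrite !ypoly_scale_zmod opprD addrACA.
- by move=> b h; rewrite !ypoly_scale_mon -ymonD -mulrDl scalD.
Qed.

HB.instance Definition _ := GRing.Zmodule_isLmodule.Build K M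
  ypoly_scaleA ypoly_scale1 ypoly_scaleDr ypoly_scaleDl.

Lemma scale_ymon (k : K) b h : k *: ymon b h = ymon b (scal k * h).
Proof. exact: ypoly_scale_mon. Qed.

End PolynomialModule.

(** * Divided difference operators *)

Section RationalJacobi.
Context (n : nat) (B : pzRingType) (w : B).
Hypothesis wC : forall a, w * a = a * w.
Context (c : 'I_n -> B) (s : 'S_n -> B) (x y : 'I_n -> B).
Local Notation br a b := (a * b - b * a).
Local Notation T := (exch c s).
Hypothesis ra : rational_action w c s x y.

(** The Jacobi identity expresses the left-hand side by the commutators of x_i and
    x_j with the known elements [x_j, y_l] and [x_i, y_l]. *)
Lemma rational_jacobi i j l : br (br (x i) (x j)) (y l) = 0.
Proof.
have [cs xl _ xy] := ra.
pose Q i := \sum_(k | k != i) qsign B i k l * T i k.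
have wCA a b : a * (w * b) = w * (a * b) by rewrite !mulrA wC.
have -> : br (br (x i) (x j)) (y l) = w * (br (x i) (Q j) - br (x j) (Q i)).
  rewrite brBl !brMl !xy -/(Q i) -/(Q j) !wCA -!(mulrA w) -!mulrDr -mulrBr.
  congr (_ * _); rewrite opprD opprB [RHS]addrACA; congr (_ + _).
  by rewrite addrC.
have Teq a b : a != b -> br (x a) (\sum_(k | k != b) T b k) = x a * T b a - x b * T a b.
  move=> ab; rewrite mulr_sumr mulr_suml -sumrB (bigD1 a) //=.
  rewrite (exch_x cs xl) 1?eq_sym // big1 ?addr0 // => k /andP[kb ka].
  by rewrite (exch_x_neq xl) ?subrr // eq_sym.
have Tneq a b : a != b -> br (x b) (- T a b) = x a * T b a - x b * T a b.
  by move=> ab; rewrite mulrN mulNr opprK (exch_x cs xl ab) addrC.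
have [->|ij] := eqVneq i j; first by rewrite subrr mulr0.
have ji : j != i by rewrite eq_sym.
have [lj|lj] := eqVneq l j; last have [li|li] := eqVneq l i.
- by rewrite /Q lj qsign_sum_eq qsign_sum_neq // Teq // Tneq // subrr mulr0.
- by rewrite /Q li qsign_sum_eq qsign_sum_neq // Teq // Tneq // subrr mulr0.
rewrite /Q !qsign_sum_neq 1?eq_sym // !mulrN !mulNr.
rewrite !(exch_x_neq xl) 1?eq_sym //.
by rewrite !subrr mulr0.
Qed.

End RationalJacobi.

Section SumDifference.
Context (V : zmodType).
Implicit Types (G : nat -> V) (p q : nat).

(** The sum of G t over q <= t < p, counted negatively if p < q. *)
Definition sum_diff G p q : V := \sum_(0 <= t < p) G t - \sum_(0 <= t < q) G t.

Lemma eq_sum_diff G G' p q :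
  (forall t, (t < p)%N || (t < q)%N -> G t = G' t) -> sum_diff G p q = sum_diff G' p q.
Proof.
move=> GG'; rewrite /sum_diff; congr (_ - _); apply: eq_big_nat => t /andP[_ lt];
  by rewrite GG' // lt ?orbT.
Qed.

Lemma sum_diffB G G' p q :
  sum_diff (fun t => G t - G' t) p q = sum_diff G p q - sum_diff G' p q.
Proof.
by rewrite /sum_diff !sumrB !opprB addrACA [RHS]addrACA [in RHS](addrC (- _)).
Qed.

Lemma sum_diffSl G p q : sum_diff G p.+1 q = sum_diff (fun t => G t.+1) p q + G q.
Proof.
have Gq : \sum_(0 <= t < q) G t.+1 = \sum_(0 <= t < q) G t + G q - G 0%N.
  have := @big_nat_recr _ _ +%R q 0%N G isT; rewrite big_nat_recl //= => <-.
  by rewrite [RHS]addrC addKr.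
rewrite /sum_diff big_nat_recl // Gq opprB opprD !addrA subrK.
by rewrite [in LHS](addrC (G 0%N)) addrAC.
Qed.

Lemma sum_diffSr G p q : sum_diff G p q.+1 = sum_diff G p q - G q.
Proof. by rewrite /sum_diff big_nat_recr //= opprD addrA. Qed.

End SumDifference.

Lemma sum_diff_morph (V W : zmodType) (f : {additive V -> W}) G p q :
  f (sum_diff G p q) = sum_diff (fun t => f (G t)) p q.
Proof. by rewrite /sum_diff raddfB !raddf_sum. Qed.

Section PolynomialOperators.
Context (K : fieldType) (n : nat) (A : assocAlgType K).
Local Notation E := {ffun 'I_n -> nat}.
Local Notation M := (ypoly n A).
Local Notation mon := (@ymon K n A).

Lemma ypoly_lendo_ext (f g : lendo M) :
  (forall b h, f (mon b h) = g (mon b h)) -> f = g.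
Proof.
move=> fg; apply: lendo_eqP; apply: ypoly_ext fg => m m'; exact: linearB.
Qed.

Section Extension.
Context (F : E -> A -> M) (FB : forall b, zmod_morphism (F b)).
Hypothesis FZ : forall b k h, F b (scal k * h) = k *: F b h.

Fact yop_linear : linear (malg_ext F : M -> M).
Proof.
move=> k m m'; pose f : {additive M -> M} := HB.pack (malg_ext F : M -> M)
  (GRing.isZmodMorphism.Build _ _ _ (malg_ext_zmod FB)).
rewrite -[LHS]/(f (k *: m + m')) -[RHS]/(k *: f m + f m') raddfD; congr (_ + _).
apply: (ypoly_ext (f := fun m => f (k *: m)) (g := fun m => k *: f m)) => [m1 m2|m1 m2|b h].
- by rewrite scalerBr raddfB.
- by rewrite raddfB scalerBr.
- rewrite scale_ymon -[LHS]/(malg_ext F (mon _ _)) malg_extU // FZ; congr (_ *: _).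
  by rewrite -[RHS]/(malg_ext F (mon _ _)) malg_extU.
Qed.

Definition yop : lendo M := Lendo yop_linear.

Lemma yop_mon b h : yop (mon b h) = F b h.
Proof. exact: malg_extU. Qed.

End Extension.

Section MonomialOperators.
Context (p : E -> E) (a : A).

Fact mon_op_zmod b : zmod_morphism (fun h => mon (p b) (a * h)).
Proof. by move=> h h'; rewrite mulrBr ymonB. Qed.

Fact mon_op_scal b (k : K) h : mon (p b) (a * (scal k * h)) = k *: mon (p b) (a * h).
Proof. by rewrite scale_ymon !mulrA scal_comm. Qed.

Definition mon_op : lendo M := yop mon_op_zmod mon_op_scal.

Lemma mon_opE b h : mon_op (mon b h) = mon (p b) (a * h).
Proof. exact: yop_mon. Qed.

End MonomialOperators.

(** (f - s_ik f) / (Y_i - Y_k) h for the monomial f with exponents b: with p and q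
    the exponents of Y_i and Y_k, it is the signed sum over q <= t < p of the
    monomials with exponents t and p + q - 1 - t. *)
Definition divdiff (i k : 'I_n) (b : E) (h : A) : M :=
  sum_diff (fun t => mon (exp_set b i t k (b i + b k - t.+1)%N) h) (b i) (b k).

Lemma divdiff_zmod i k b : zmod_morphism (divdiff i k b).
Proof.
by move=> h h'; rewrite -sum_diffB; apply: eq_sum_diff => t _; rewrite ymonB.
Qed.

Lemma divdiffN i k b h : divdiff i k b (- h) = - divdiff i k b h.
Proof.
have d0 : divdiff i k b 0 = 0 by rewrite -(subrr 0) divdiff_zmod subrr.
by rewrite -[- h]sub0r divdiff_zmod d0 sub0r.
Qed.

Lemma lendo_divdiff (f : lendo M) i k b h : f (divdiff i k b h) =
  sum_diff (fun t => f (mon (exp_set b i t k (b i + b k - t.+1)%N) h)) (b i) (b k).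
Proof. exact: sum_diff_morph. Qed.

Lemma divdiff_scale i k b l h : divdiff i k b (scal l * h) = l *: divdiff i k b h.
Proof.
rewrite -[RHS]/((scal l : lendo M) _) lendo_divdiff.
by apply: eq_sum_diff => t _; rewrite lendo_scalE scale_ymon.
Qed.

Definition ymul (l : 'I_n) : lendo M := mon_op (fun b => expS b l) 1.

Lemma ymulE l b h : ymul l (mon b h) = mon (expS b l) h.
Proof. by rewrite mon_opE mul1r. Qed.

(** Y_l shifts the exponents injectively. *)
Lemma ymul_inj l m : ymul l m = 0 -> m = 0.
Proof.
move=> m0; apply/malgP => b; have -> : mcoeff b m = ycoef (expS b l) (ymul l m).
  apply: (ypoly_ext (f := ycoef b) (g := fun m => ycoef (expS b l) (ymul l m))).
  - by move=> m1 m2; rewrite ycoefB.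
  - by move=> m1 m2; rewrite linearB ycoefB.
  - by move=> b' h; rewrite ymulE !ycoef_ymon (inj_eq (@expS_inj _ l)).
by rewrite m0 /ycoef !mcoeff0.
Qed.

Lemma lendo_qsign (i k l : 'I_n) (f : lendo M) m : (qsign (lendo M) i k l * f) m =
  f m *+ (l == i) - f m *+ (l == k).
Proof.
rewrite /qsign mulrBl lendoDE lendoNE.
by congr (_ - _); case: (l == _); rewrite ?mul1r ?mul0r ?lendo0E.
Qed.

(** The twisted Leibniz rule for Y_l f. *)
Lemma divdiffS i k l b h : i != k -> divdiff i k (expS b l) h =
  ymul l (divdiff i k b h) + (mon (exp_perm (tperm k i) b) h *+ (l == i)
                              - mon (exp_perm (tperm k i) b) h *+ (l == k)).
Proof.
move=> ik; have ki : k != i by rewrite eq_sym.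
pose G t := mon (exp_set b i t k (b i + b k - t)%N) h.
have Gk : G (b k) = mon (exp_perm (tperm k i) b) h.
  rewrite /G addnK; congr mon; apply/ffunP => j; rewrite !ffunE tpermV.
  by case: tpermP => [->|->|/eqP /negPf -> /eqP /negPf ->]; rewrite ?eqxx // (negPf ki).
rewrite lendo_divdiff -Gk /divdiff.
have [->|li] := eqVneq l i; last have [->|lk] := eqVneq l k.
- have -> : expS b i i = (b i).+1 by rewrite ffunE eqxx addn1.
  have -> : expS b i k = b k by rewrite ffunE (negPf ki) addn0.
  rewrite (negPf ik) subr0 -(eq_sum_diff (G := G)) => [|t _].
    rewrite sum_diffSl; congr (_ + _); apply: eq_sum_diff => t _.
    rewrite ymulE /G; congr mon; apply/ffunP => j; rewrite !ffunE.
    by case: eqP => _; rewrite ?addn1 ?addn0.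
  rewrite /G addSn subSS; congr mon; apply/ffunP => j; rewrite !ffunE.
  by case: eqP => _; rewrite ?addn0.
- have -> : expS b k i = b i by rewrite ffunE (negPf ik) addn0.
  have -> : expS b k k = (b k).+1 by rewrite ffunE eqxx addn1.
  rewrite sub0r -(eq_sum_diff (G := G)) => [|t _].
    rewrite sum_diffSr; congr (_ - _); apply: eq_sum_diff => t lt.
    rewrite ymulE /G; congr mon; apply/ffunP => j; rewrite !ffunE.
    have [->|jk] := eqVneq j k; last by rewrite addn0.
    by rewrite (negPf ki) addn1; lia.
  rewrite /G addnS subSS; congr mon; apply/ffunP => j; rewrite !ffunE.
  by case: eqP => // _; case: eqP => _; rewrite ?addn0.
- have -> : expS b l i = b i by rewrite ffunE [i == l]eq_sym (negPf li) addn0.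
  have -> : expS b l k = b k by rewrite ffunE [k == l]eq_sym (negPf lk) addn0.
  rewrite subrr addr0; apply: eq_sum_diff => t _; rewrite ymulE; congr mon.
  apply/ffunP => j; rewrite !ffunE; have [->|ji] := eqVneq j i.
    by rewrite [i == l]eq_sym (negPf li) addn0.
  by have [->|//] := eqVneq j k; rewrite [k == l]eq_sym (negPf lk) addn0.
Qed.

Lemma divdiff_op (p : 'S_n) a i k b h :
  mon_op (exp_perm p) a (divdiff i k b h) =
  divdiff (p i) (p k) (exp_perm p b) (a * h).
Proof.
have E l : exp_perm p b (p l) = b l by rewrite ffunE permK.
rewrite lendo_divdiff /divdiff !E.
by apply: eq_sum_diff => t _; rewrite mon_opE exp_perm_set.
Qed.

End PolynomialOperators.

(** * The action on polynomials, and torsion-freeness *)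

Section PolynomialAction.
Context (K : fieldType) (n : nat) (A : assocAlgType K) (u : K).
Context (c : 'I_n -> A) (s : 'S_n -> A) (x y : 'I_n -> A).
Hypothesis ra : rational_action (scal u) c s x y.
Hypothesis xx : forall i j, x i * x j = x j * x i.
Local Notation E := {ffun 'I_n -> nat}.
Local Notation M := (ypoly n A).
Local Notation mon := (@ymon K n A).
Local Notation T := (exch c s).
Let cs := ra_cs ra.
Let xl := ra_x ra.
Let yl := ra_y ra.

Definition cmul (j : 'I_n) : lendo M := mon_op id (c j).
Definition smul (p : 'S_n) : lendo M := mon_op (exp_perm p) (s p).

Definition xmul_mon (i : 'I_n) (b : E) (h : A) : M :=
  mon b (x i * h) + \sum_(k | k != i) u *: divdiff i k b (T i k * h).

Fact xmul_zmod i b : zmod_morphism (xmul_mon i b).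
Proof.
move=> h h'; rewrite /xmul_mon mulrBr ymonB opprD addrACA -sumrB; congr (_ + _).
by apply: eq_bigr => k _; rewrite mulrBr divdiff_zmod scalerBr.
Qed.

Fact xmul_scal i b k h : xmul_mon i b (scal k * h) = k *: xmul_mon i b h.
Proof.
rewrite /xmul_mon scalerDr scaler_sumr scale_ymon mulrA -scal_comm -mulrA; congr (_ + _).
apply: eq_bigr => l _.
by rewrite mulrA -scal_comm -mulrA divdiff_scale !scalerA mulrC.
Qed.

Definition xmul (i : 'I_n) : lendo M := yop (xmul_zmod i) (xmul_scal i).
Local Notation ymul := (@ymul K n A).

Lemma cmulE j b h : cmul j (mon b h) = mon b (c j * h).
Proof. exact: mon_opE. Qed.
Lemma smulE p b h : smul p (mon b h) = mon (exp_perm p b) (s p * h).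
Proof. exact: mon_opE. Qed.
Lemma xmulE i b h : xmul i (mon b h) = xmul_mon i b h.
Proof. exact: yop_mon. Qed.

Lemma cmul_divdiff j i k b h : cmul j (divdiff i k b h) = divdiff i k b (c j * h).
Proof.
by rewrite lendo_divdiff; apply: eq_sum_diff => t _; rewrite cmulE.
Qed.

Lemma exch_mulE i k b h :
  exch cmul smul i k (mon b h) = mon (exp_perm (tperm k i) b) (T i k * h).
Proof.
rewrite !exch_def lendoME smulE lendoDE lendo1E lendoME !cmulE -ymonD -!mulrA.
by rewrite mulrDl mul1r -!mulrA.
Qed.

(** The commutators with the Y_l come from [divdiffS]; the relations of x_i with
    the c_j and S_n hold because T_ik transforms like x_i under them. *)
Lemma ypoly_action : rational_action (scal u) cmul smul xmul ymul.
Proof.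
have ext := @ypoly_lendo_ext K n A; split; first split.
- by apply: ext => b h; rewrite smulE exp_perm1 (sgv_s1 cs) mul1r lendo1E.
- by move=> p q; apply: ext => b h; rewrite lendoME !smulE exp_permM mulrA (sgv_sM cs).
- by move=> p i; apply: ext => b h; rewrite !lendoME !(smulE, cmulE) !mulrA (sgv_sc cs).
- by move=> i; apply: ext => b h; rewrite lendoME !cmulE mulrA (sgv_c2 cs) mul1r lendo1E.
- move=> i j ij; apply: ext => b h.
  by rewrite lendoNE !lendoME !cmulE !mulrA (sgv_cc cs ij) mulNr ymonN.
- split=> [p i|i|i j ij].
  + apply: ext => b h; rewrite !lendoME smulE !xmulE /xmul_mon linearD linear_sum /=.
    rewrite smulE !mulrA (xl_s xl); congr (_ + _).
    rewrite [RHS](reindex_inj (@perm_inj _ p)) /=; apply: eq_big => [k|k ki].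
      by rewrite (inj_eq perm_inj).
    by rewrite linearZ /= divdiff_op !mulrA (exch_s cs).
  + apply: ext => b h; rewrite lendoNE !lendoME cmulE !xmulE /xmul_mon linearD linear_sum /=.
    rewrite cmulE !mulrA (xl_c xl) mulNr ymonN opprD -sumrN; congr (_ + _).
    apply: eq_bigr => k ki; rewrite linearZ /= cmul_divdiff !mulrA (exch_c cs) 1?eq_sym //.
    by rewrite !mulNr divdiffN scalerN.
  + apply: ext => b h; rewrite !lendoME cmulE !xmulE /xmul_mon linearD linear_sum /=.
    rewrite cmulE !mulrA (xl_c_neq xl ij); congr (_ + _).
    apply: eq_bigr => k ki; rewrite linearZ /= cmul_divdiff !mulrA (exch_c_neq cs) //.
    by rewrite eq_sym.
- split=> [p i|i j|i j].
  + by apply: ext => b h; rewrite !lendoME !(smulE, ymulE) exp_permS.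
  + apply: ext => b h; rewrite !lendoME !(cmulE, ymulE). by [].
  + by apply: ext => b h; rewrite !lendoME !ymulE expSC.
- move=> i l; apply: ext => b h; rewrite lendoDE lendoNE !lendoME ymulE !xmulE.
  rewrite lendo_scalE lendo_sumE scaler_sumr /xmul_mon linearD linear_sum /= ymulE.
  rewrite opprD addrACA subrr add0r -sumrB; apply: eq_bigr => k ki.
  rewrite linearZ /= -scalerBr; congr (_ *: _).
  have ik : i != k by rewrite eq_sym.
  by rewrite (divdiffS _ _ _ ik) addrC addKr lendo_qsign exch_mulE.
Qed.

(** The commutator commutes with every Y_l ([rational_jacobi]), and on constants
    the divided differences vanish, so that x_i acts there by left multiplication
    in A. *)
Lemma xmulC i j : xmul i * xmul j = xmul j * xmul i.
Proof.
apply/eqP; rewrite -subr_eq0; apply/eqP; apply: ypoly_lendo_ext => b h.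
have wC (f : lendo M) : scal u * f = f * scal u by exact: scal_comm.
pose Z : lendo M := xmul i * xmul j - xmul j * xmul i; rewrite -/Z lendo0E.
have ZY l : Z * ymul l = ymul l * Z.
  exact: subr0_eq (rational_jacobi wC ypoly_action i j l).
have x0 l h' : xmul l (mon (exp0 n) h') = mon (exp0 n) (x l * h').
  rewrite xmulE /xmul_mon big1 ?addr0 // => k _.
  by rewrite /divdiff !ffunE /sum_diff big_geq // subrr scaler0.
elim/exp_ind: b => [|b l Zb].
  by rewrite lendoDE lendoNE !lendoME !x0 -ymonB !mulrA xx subrr ymon0.
by rewrite -ymulE -lendoME ZY lendoME Zb linear0.
Qed.

Definition ypow (b : E) : A := \prod_(j < n) y j ^+ b j.

Lemma ypowS b l : ypow (expS b l) = y l * ypow b.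
Proof.
have pC (b' : E) i j : y i ^+ b' i * y j ^+ b' j = y j ^+ b' j * y i ^+ b' i.
  by apply/commrX/commr_sym/commrX; apply: (yl_y yl).
rewrite /ypow !(commuting_prod_split l) => [|i j|i j]; try exact: pC.
rewrite mulrA ffunE eqxx addn1 exprS; congr (_ * _).
by apply: eq_bigr => j jl; rewrite ffunE (negPf jl) addn0.
Qed.

(** The evaluation of Y_i at y_i.  It intertwines the action on polynomials with
    left multiplication in A. *)
Definition ypoly_eval : M -> A := malg_ext (fun b h => ypow b * h).

Lemma ypoly_eval_zmod : zmod_morphism ypoly_eval.
Proof. by apply: malg_ext_zmod => b h h'; rewrite mulrBr. Qed.

HB.instance Definition _ := GRing.isZmodMorphism.Build M A ypoly_eval ypoly_eval_zmod.

Lemma ypoly_evalE b h : ypoly_eval (mon b h) = ypow b * h.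
Proof. by apply: malg_extU => b' h1 h2; rewrite mulrBr. Qed.

Lemma ypoly_eval_ext (f : lendo M) a :
  (forall b h, ypoly_eval (f (mon b h)) = a * ypoly_eval (mon b h)) ->
  forall m, ypoly_eval (f m) = a * ypoly_eval m.
Proof.
move=> fa; apply: (ypoly_ext (f := fun m => ypoly_eval (f m))
  (g := fun m => a * ypoly_eval m)) => [m1 m2|m1 m2|//].
- by rewrite !raddfB.
- by rewrite raddfB mulrBr.
Qed.

Lemma ypoly_evalZ (k : K) m : ypoly_eval (k *: m) = scal k * ypoly_eval m.
Proof.
rewrite -[k *: m]/((scal k : lendo M) m); apply: ypoly_eval_ext m => b h.
by rewrite lendo_scalE scale_ymon !ypoly_evalE mulrA -scal_comm -mulrA.
Qed.

Lemma ypoly_eval_y l m : ypoly_eval (ymul l m) = y l * ypoly_eval m.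
Proof.
by apply: ypoly_eval_ext m => b h; rewrite ymulE !ypoly_evalE ypowS mulrA.
Qed.

Lemma ypoly_eval_c j m : ypoly_eval (cmul j m) = c j * ypoly_eval m.
Proof.
apply: ypoly_eval_ext m => b h; rewrite cmulE !ypoly_evalE !mulrA; congr (_ * _).
by apply/esym/commr_prod => i _; apply/commrX; rewrite /GRing.comm (yl_c yl).
Qed.

Lemma ypoly_eval_s p m : ypoly_eval (smul p m) = s p * ypoly_eval m.
Proof.
apply: ypoly_eval_ext m => b h; rewrite smulE !ypoly_evalE !mulrA; congr (_ * _).
elim/exp_ind: b => [|b l IHb].
  rewrite (_ : exp_perm p _ = exp0 n); last by apply/ffunP => j; rewrite !ffunE.
  by rewrite /ypow big1 ?mul1r ?mulr1 // => j _; rewrite ffunE.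
by rewrite exp_permS !ypowS -mulrA IHb !mulrA (yl_s yl).
Qed.

(** By induction on the exponents: x_i y_l and its counterpart on polynomials are
    moved past each other by the same commutator formula. *)
Lemma ypoly_eval_x i m : ypoly_eval (xmul i m) = x i * ypoly_eval m.
Proof.
apply: ypoly_eval_ext m => b; elim/exp_ind: b => [|b l IHb] h.
  rewrite xmulE /xmul_mon big1 ?addr0 => [|k _]; last first.
    by rewrite /divdiff !ffunE /sum_diff big_geq // subrr scaler0.
  rewrite !ypoly_evalE (_ : ypow _ = 1) ?mul1r //.
  by rewrite /ypow big1 // => j _; rewrite ffunE.
rewrite -ymulE -lendoME.
have /eqP := ra_xy ypoly_action i l; rewrite subr_eq addrC => /eqP ->.
have eval_T k m : ypoly_eval (exch cmul smul i k m) = exch c s i k * ypoly_eval m.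
  rewrite !exch_def lendoME lendoDE lendo1E lendoME raddfD /= !ypoly_eval_c !ypoly_eval_s.
  by rewrite -mulrA mulrDl mul1r -mulrA.
rewrite lendoDE lendoME raddfD /= ypoly_eval_y IHb ypoly_eval_y !mulrA.
have /eqP := ra_xy ra i l; rewrite subr_eq addrC => /eqP ->.
rewrite mulrDl; congr (_ + _).
rewrite lendoME lendo_scalE ypoly_evalZ -[RHS]mulrA lendo_sumE raddf_sum mulr_suml; congr (_ * _).
apply: eq_bigr => k _; rewrite lendo_qsign raddfB !raddfMn /= eval_T.
rewrite mulNrn /qsign !mulrBl -!mulrA.
by congr (_ - _); case: (l == _); rewrite ?mul1r ?mul0r.
Qed.

End PolynomialAction.

Section RationalTorsionFree.
Context (K : fieldType) (n : nat) (u : K).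

(** If z a = 0, then z kills the polynomial a . 1, which is therefore 0; but its
    evaluation is a. *)
Lemma ry_prod_regular (a : rdaha n u) : ry_prod n u * a = 0 -> a = 0.
Proof.
have [ra xx] := rdaha_action n u.
pose rho := pres_lift (rational_lift (ypoly_action ra) (xmulC ra xx)).
have scalE k : rho (scal k) = scal k by exact: pres_lift_scal.
have genE g : rho (pgen _ g) = rgen_map (cmul (@rc K n u)) (smul (@rs K n u))
    (xmul u (@rc K n u) (@rs K n u) (@rx K n u)) (@ymul K n (rdaha n u)) g.
  exact: pres_lift_gen.
have ev_rho b m : ypoly_eval (@ry K n u) (rho b m) = b * ypoly_eval (@ry K n u) m.
  elim/pres_ind: b m => [m|b b' IHb IHb' m|k m|k b IHb m|g b IHb m].
  - by rewrite rmorph0 lendo0E mul0r raddf0.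
  - by rewrite rmorphD lendoDE raddfD /= IHb IHb' mulrDl.
  - by rewrite scalE lendo_scalE ypoly_evalZ.
  - by rewrite rmorphM scalE lendoME lendo_scalE ypoly_evalZ IHb mulrA.
  rewrite rmorphM /= genE lendoME -mulrA -IHb; case: g => [i|i|i|p] /=.
  - exact: (ypoly_eval_x ra).
  - exact: (ypoly_eval_y ra).
  - exact: (ypoly_eval_c ra).
  - exact: (ypoly_eval_s ra).
move=> za; have rho_z_inj m : rho (ry_prod n u) m = 0 -> m = 0.
  rewrite /ry_prod rmorph_prod; elim: (index_enum _) m => [|i r IHr] m.
    by rewrite big_nil lendo1E.
  by rewrite big_cons lendoME genE => /ymul_inj /IHr.
have rho_a : rho a (ymon (exp0 n) 1) = 0.
  by apply: rho_z_inj; rewrite -lendoME -rmorphM za rmorph0.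
have := ev_rho a (ymon (exp0 n) 1); rewrite rho_a raddf0 ypoly_evalE /ypow.
by rewrite big1 ?mulr1 // => j _; rewrite ffunE.
Qed.

End RationalTorsionFree.

(** * Parity and localization *)

Section Parity.
Context (K : fieldType) (X : choiceType) (R : freeAlg K X -> freeAlg K X -> Prop).
Context (odd_gen : pred X).
Local Notation hom := (@homogeneous K X R odd_gen).

Lemma homogeneous0 p : hom p 0.
Proof. by exists 0; rewrite ?rmorph0 // /fsupp msupp0. Qed.

Lemma homogeneousD p a b : hom p a -> hom p b -> hom p (a + b).
Proof.
move=> [f fp ->] [g gp ->]; exists (f + g); last by rewrite rmorphD.
by move=> v /(fsubsetP (msuppD_le _ _)); rewrite inE => /orP[/fp|/gp].
Qed.

Lemma homogeneousN p a : hom p a -> hom p (- a).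
Proof.
move=> [f fp ->]; exists (- f); last by rewrite rmorphN.
by move=> v; rewrite /fsupp msuppN; apply: fp.
Qed.

Lemma homogeneous_sum p (J : Type) (r : seq J) (P : pred J) (F : J -> pres R) :
  (forall j, P j -> hom p (F j)) -> hom p (\sum_(j <- r | P j) F j).
Proof.
move=> Fp; elim/big_rec: _ => [|j a Pj]; first exact: homogeneous0.
by apply: homogeneousD; apply: Fp.
Qed.

Lemma homogeneousM p q a b : hom p a -> hom q b -> hom (p (+) q) (a * b).
Proof.
move=> [f fp ->] [g gq ->]; exists (f * g); last by rewrite rmorphM.
move=> v; rewrite /fsupp freeME => /msuppM_le[v1] [v2] [/fp fv1 /gq gv2 ->].
by rewrite fmM count_cat oddD fv1 gv2.
Qed.

Lemma homogeneous_scal k : hom false (scal k).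
Proof.
exists (scal k) => // v; rewrite /fsupp [scal k]free_scalE.
by move=> /(fsubsetP (msuppC_le _)); rewrite inE => /eqP ->; rewrite fm1.
Qed.

Lemma homogeneous1 : hom false 1.
Proof. by rewrite -scal1; apply: homogeneous_scal. Qed.

Lemma homogeneous_gen x : hom (odd_gen x) (pgen R x).
Proof.
exists (fgen K x) => // v; rewrite /fsupp fgenE.
by move=> /(fsubsetP msuppU_le); rewrite inE => /eqP ->; rewrite fmU /= addn0 oddb.
Qed.

End Parity.

(** A homomorphism respects the grading as soon as it does so on generators. *)
Lemma pres_lift_homogeneous (K : fieldType) (X Y : choiceType)
    (R : freeAlg K X -> freeAlg K X -> Prop) (Q : freeAlg K Y -> freeAlg K Y -> Prop)
    (oddX : pred X) (oddY : pred Y) (g : X -> pres Q)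
    (gP : forall l r, R l r -> feval g l = feval g r) p a :
  (forall x, homogeneous oddY (oddX x) (g x)) ->
  homogeneous oddX p a -> homogeneous oddY p (pres_lift gP a).
Proof.
move=> g_odd [f fp ->]; rewrite [pres_lift _ _]pres_liftE /feval big_seq_cond.
apply: homogeneous_sum => v /andP[/fp <- _].
rewrite -[odd _]addFb; apply: homogeneousM; first exact: homogeneous_scal.
rewrite /fword; elim: (fmonom_val v) => [|x r IHr].
  by rewrite big_nil; apply: homogeneous1.
by rewrite big_cons /= oddD oddb; apply: homogeneousM.
Qed.

Section LocalizationLift.
Context (K : pzRingType) (A : assocAlgType K) (z : A) (zC : central z).
Context (B : pzRingType) (f : {rmorphism A -> B}) (v : B).

(** The inverse v of f z is a parameter, and its two defining equations are
    arguments of the map because the ring morphism structure depends on them. *)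
Definition loc_lift_of (_ : f z * v = 1) (_ : v * f z = 1) (q : cloc zC) : B :=
  v ^+ (repr q).2 * f (repr q).1.

Hypotheses (fzv : f z * v = 1) (vfz : v * f z = 1).
Local Notation lift := (loc_lift_of fzv vfz).

Let vX k : v ^+ k * f z ^+ k = 1.
Proof.
elim: k => [|k IHk]; first by rewrite mulr1.
by rewrite exprSr exprS -mulrA (mulrA v) vfz mul1r.
Qed.

Let vC a k : v ^+ k * f a = f a * v ^+ k.
Proof.
(* z is central, hence f z and its inverse commute with the image of f. *)
apply/commr_sym/commrX/commr_sym.
by apply: (inv_commutes fzv vfz); rewrite -!rmorphM zC.
Qed.

Lemma loc_liftE a k : lift (Defs.frac zC a k) = v ^+ k * f a.
Proof.
rewrite /loc_lift_of; have [p] := repr_frac zC a k.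
case: (repr _) => [a' k'] /= /(congr1 f); rewrite !rmorphM !rmorphXn => E.
rewrite -[f a']mul1r -(vX (p + k)) -[_ * f a']mulrA E !mulrA.
have -> : v ^+ k' * v ^+ (p + k) = v ^+ k * v ^+ (p + k').
  by rewrite -!exprD; congr (_ ^+ _); lia.
by rewrite -(mulrA (v ^+ k)) vX mulr1.
Qed.

Fact loc_lift_zmod : zmod_morphism lift.
Proof.
move=> q r; have [a [k ->]] := frac_surj q; have [b [m ->]] := frac_surj r.
rewrite fracN fracD !loc_liftE mulrN rmorphB !rmorphM !rmorphXn mulrBr.
rewrite {1}exprD -!(mulrA (v ^+ k)) (mulrA (v ^+ m)) vX mul1r addnC exprD.
by rewrite -(mulrA (v ^+ m)) (mulrA (v ^+ k)) vX mul1r.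
Qed.

Fact loc_lift_monoid : monoid_morphism lift.
Proof.
split=> [|q r]; first by rewrite [LHS]loc_liftE rmorph1 mulr1.
have [a [k ->]] := frac_surj q; have [b [m ->]] := frac_surj r.
by rewrite fracM !loc_liftE exprD rmorphM !mulrA -(mulrA _ _ (f a)) vC !mulrA.
Qed.

HB.instance Definition _ := GRing.isZmodMorphism.Build (cloc zC) B lift loc_lift_zmod.
HB.instance Definition _ := GRing.isMonoidMorphism.Build (cloc zC) B lift loc_lift_monoid.

Definition loc_lift : {rmorphism cloc zC -> B} := lift.

Lemma loc_lift_in a : loc_lift (loc_in zC a) = f a.
Proof. by rewrite [LHS]loc_liftE mul1r. Qed.

End LocalizationLift.

(** * The isomorphism *)

Section ActionMorphism.
Context (n : nat) (A B : pzRingType) (f : {rmorphism A -> B}).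
Context (c : 'I_n -> A) (s : 'S_n -> A) (x y : 'I_n -> A) (w : A).

Lemma rmorph_exch i k : f (exch c s i k) = exch (f \o c) (f \o s) i k.
Proof. by rewrite !exch_def rmorphM rmorphD rmorph1 rmorphM. Qed.

Lemma rmorph_jucys i : f (jucys c s i) = jucys (f \o c) (f \o s) i.
Proof.
by rewrite !jucys_def rmorph_sum; apply: eq_bigr => k _; rewrite rmorph_exch.
Qed.

Lemma rmorph_cherednik i : f (cherednik w c s x y i) =
  cherednik (f w) (f \o c) (f \o s) (f \o x) (f \o y) i.
Proof. by rewrite /cherednik rmorphD !rmorphM rmorph_jucys. Qed.

Lemma rational_action_morph : rational_action w c s x y ->
  rational_action (f w) (f \o c) (f \o s) (f \o x) (f \o y).
Proof.
move=> [cs xl yl xy]; split.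
- split=> [|p q|p i|i|i j ij] /=; rewrite -?rmorphM.
  + by rewrite (sgv_s1 cs) rmorph1.
  + by rewrite (sgv_sM cs).
  + by rewrite (sgv_sc cs).
  + by rewrite (sgv_c2 cs) rmorph1.
  + by rewrite (sgv_cc cs ij) rmorphN.
- split=> [p i|i|i j ij] /=; rewrite -!rmorphM.
  + by rewrite (xl_s xl).
  + by rewrite (xl_c xl) rmorphN.
  + by rewrite (xl_c_neq xl ij).
- split=> [p i|i j|i j] /=; rewrite -!rmorphM.
  + by rewrite (yl_s yl).
  + by rewrite (yl_c yl).
  + by rewrite (yl_y yl).
move=> i l /=; rewrite -!rmorphM -rmorphB xy rmorphM rmorph_sum; congr (_ * _).
apply: eq_bigr => k _; rewrite rmorphM rmorph_exch; congr (_ * _).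
by rewrite /qsign rmorphB !rmorph_nat.
Qed.

End ActionMorphism.

Section Isomorphism.
Context (K : fieldType) (n : nat) (u : K).
Local Notation A := (rdaha n u).
Local Notation B := (tdaha n u).
Local Notation L := (rdaha_loc n u).
Local Notation rc := (@rc K n u).
Local Notation rs := (@rs K n u).
Local Notation rx := (@rx K n u).
Local Notation ry := (@ry K n u).
Local Notation tc := (@tc K n u).
Local Notation ts := (@ts K n u).
Local Notation te := (@te K n u).
Local Notation teV := (@teV K n u).
Local Notation td := (@td K n u).
Local Notation inL := (rdaha_to_loc u : {rmorphism A -> L}).

Let uC (D : assocAlgType K) (a : D) : scal u * a = a * scal u.
Proof. exact: scal_comm. Qed.

(** The image of x_i in the trigonometric algebra. *)
Definition tx (i : 'I_n) : B := teV i * (td i - scal u * jucys tc ts i).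

Let tdaha_rational := trigonometric_to_rational (@uC B) (tdaha_action n u).

Lemma tx_action : rational_action (scal u) tc ts tx te.
Proof. by case: tdaha_rational. Qed.

Lemma txC i j : tx i * tx j = tx j * tx i.
Proof. by case: tdaha_rational => _ H _; apply: H. Qed.

Lemma td_cherednik i : td i = cherednik (scal u) tc ts tx te i.
Proof. by case: tdaha_rational => _ _; apply. Qed.

Definition rat_to_trig : {rmorphism A -> B} := pres_lift (rational_lift tx_action txC).

Lemma rat_to_trig_gen g : rat_to_trig (pgen _ g) = rgen_map tc ts tx te g.
Proof. exact: pres_lift_gen. Qed.

Lemma rat_to_trig_scal : fixes_scalars rat_to_trig.
Proof. exact: pres_lift_scal. Qed.

Let ryC i j : ry i * ry j = ry j * ry i.
Proof. by have [ra _] := rdaha_action n u; apply: (yl_y (ra_y ra)). Qed.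

(** The inverse of y_i in the localization: the product of the other y_j, divided
    by z. *)
Definition lyV (i : 'I_n) : L :=
  Defs.frac (@ry_prod_central K n u) (\prod_(j | j != i) ry j) 1.

Let inLE a : inL a = Defs.frac (@ry_prod_central K n u) a 0.
Proof. by []. Qed.

Lemma lyVr i : inL (ry i) * lyV i = 1.
Proof.
rewrite inLE fracM -(commuting_prod_split _ ryC).
by apply: fracP; rewrite mulr1 mul1r.
Qed.

Lemma lyVl i : lyV i * inL (ry i) = 1.
Proof.
rewrite -[RHS](lyVr i) inLE !fracM; congr Defs.frac.
by apply/esym/commr_prod => j _; apply: ryC.
Qed.

Lemma loc_action :
  trigonometric_action (scal u) (inL \o rc) (inL \o rs) (inL \o ry) lyV
    (inL \o cherednik (scal u) rc rs rx ry).
Proof.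
have [ra xx] := rdaha_action n u.
have raL := rational_action_morph inL ra.
have xxL i j : inL (rx i) * inL (rx j) = inL (rx j) * inL (rx i).
  by rewrite -!(rmorphM inL) xx.
have := rational_to_trigonometric (@uC L) raL xxL lyVr lyVl; congr trigonometric_action.
by apply/funext => i; rewrite /= rmorph_cherednik.
Qed.

Definition trig_to_loc : {rmorphism B -> L} := pres_lift (trigonometric_lift loc_action).

Lemma trig_to_loc_gen g : trig_to_loc (pgen _ g) = tgen_map (inL \o rc) (inL \o rs) (inL \o ry)
  lyV (inL \o cherednik (scal u) rc rs rx ry) g.
Proof. exact: pres_lift_gen. Qed.

Lemma trig_to_loc_c i : trig_to_loc (tc i) = inL (rc i). Proof. exact: (trig_to_loc_gen (TC i)). Qed.
Lemma trig_to_loc_s p : trig_to_loc (ts p) = inL (rs p). Proof. exact: (trig_to_loc_gen (TS p)). Qed.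
Lemma trig_to_loc_e i : trig_to_loc (te i) = inL (ry i). Proof. exact: (trig_to_loc_gen (TE i)). Qed.
Lemma trig_to_loc_eV i : trig_to_loc (teV i) = lyV i. Proof. exact: (trig_to_loc_gen (TEV i)). Qed.
Lemma trig_to_loc_d i : trig_to_loc (td i) = inL (cherednik (scal u) rc rs rx ry i).
Proof. exact: (trig_to_loc_gen (TD i)). Qed.
Lemma trig_to_loc_scal : fixes_scalars trig_to_loc. Proof. exact: pres_lift_scal. Qed.

Lemma trig_to_loc_jucys i : trig_to_loc (jucys tc ts i) = inL (jucys rc rs i).
Proof.
rewrite (rmorph_jucys trig_to_loc) (rmorph_jucys inL).
have -> : trig_to_loc \o tc = inL \o rc by apply/funext => j; exact: trig_to_loc_c.
by have -> : trig_to_loc \o ts = inL \o rs by apply/funext => j; exact: trig_to_loc_s.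
Qed.

Lemma trig_to_loc_rat_to_trig a : trig_to_loc (rat_to_trig a) = inL a.
Proof.
apply: (@pres_hom_ext _ _ _ _ (trig_to_loc \o rat_to_trig : {rmorphism A -> L}) inL) => [k|g].
  exact: etrans (congr1 trig_to_loc (rat_to_trig_scal k)) (trig_to_loc_scal k).
change (trig_to_loc (rat_to_trig (pgen (rdaha_rel u) g)) = inL (pgen (rdaha_rel u) g)); rewrite rat_to_trig_gen; case: g => [i|i|i|p].
- rewrite [rgen_map _ _ _ _ _]/(tx i) /tx (rmorphM trig_to_loc) (rmorphB trig_to_loc) (rmorphM trig_to_loc).
  rewrite trig_to_loc_eV trig_to_loc_d trig_to_loc_jucys trig_to_loc_scal /cherednik (rmorphD inL) !(rmorphM inL).
  by rewrite addrK mulrA lyVl mul1r.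
- exact: trig_to_loc_e.
- exact: trig_to_loc_c.
- exact: trig_to_loc_s.
Qed.

Lemma rat_to_trig_ry_prod_unit : exists v : B, rat_to_trig (ry_prod n u) * v = 1 /\ v * rat_to_trig (ry_prod n u) = 1.
Proof.
have [_ _ eV Ve _ _ _ _ _ _] := tdaha_action n u.
rewrite /ry_prod rmorph_prod; elim: (index_enum _) => [|i r [v [Pv vP]]].
  by exists 1; rewrite big_nil mulr1.
exists (v * teV i); rewrite big_cons (rat_to_trig_gen (RY i)) /=; split.
  by rewrite -mulrA (mulrA _ v) Pv mul1r eV.
by rewrite -mulrA (mulrA (teV i)) Ve mul1r.
Qed.

Section LocToTrig.
Variables (v : B) (zv : rat_to_trig (ry_prod n u) * v = 1) (vz : v * rat_to_trig (ry_prod n u) = 1).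

Definition loc_to_trig : {rmorphism L -> B} := loc_lift (@ry_prod_central K n u) zv vz.

Lemma loc_to_trig_in a : loc_to_trig (inL a) = rat_to_trig a.
Proof. exact: loc_lift_in. Qed.

Lemma loc_to_trig_scal : fixes_scalars loc_to_trig.
Proof. by move=> k; rewrite -rat_to_trig_scal -loc_to_trig_in. Qed.

(** A fraction a / z^k is determined by its product with the invertible z^k, so it
    suffices to treat elements of the rational algebra. *)
Lemma loc_to_trigK : cancel loc_to_trig trig_to_loc.
Proof.
move=> q; have [a [k ->]] := @frac_surj _ _ _ (@ry_prod_central K n u) q.
have frac_mul : Defs.frac (@ry_prod_central K n u) a k * inL (ry_prod n u ^+ k) = inL a.
  rewrite !inLE fracM addn0; apply: fracP.
  by rewrite mul1r; apply/commrX/esym/ry_prod_central.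
have frac_inv : inL (ry_prod n u ^+ k) * Defs.frac (@ry_prod_central K n u) 1 k = 1.
  by rewrite !inLE fracM; apply: fracP; rewrite !mulr1 mul1r.
rewrite -[LHS]mulr1 -[RHS]mulr1 -frac_inv !mulrA frac_mul; congr (_ * _).
by rewrite -{1}trig_to_loc_rat_to_trig -(loc_to_trig_in (_ ^+ k)) -(rmorphM trig_to_loc) -(rmorphM loc_to_trig) frac_mul
  loc_to_trig_in trig_to_loc_rat_to_trig.
Qed.

Lemma trig_to_locK : cancel trig_to_loc loc_to_trig.
Proof.
have [_ _ eV Ve _ _ _ _ _ _] := tdaha_action n u.
apply: (@pres_hom_ext _ _ _ _ (loc_to_trig \o trig_to_loc : {rmorphism B -> B}) idfun) => [k|g].
  exact: etrans (congr1 loc_to_trig (trig_to_loc_scal k)) (loc_to_trig_scal k).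
change (loc_to_trig (trig_to_loc (pgen (tdaha_rel u) g)) = pgen (tdaha_rel u) g).
have je i : loc_to_trig (trig_to_loc (te i)) = te i.
  by rewrite trig_to_loc_e loc_to_trig_in (rat_to_trig_gen (RY i)).
case: g => [i|i|i|i|p].
- exact: je.
- rewrite -/(teV i) -[LHS]mul1r -(Ve i) -{1}(je i) -mulrA -!(rmorphM loc_to_trig).
  by rewrite -!(rmorphM trig_to_loc) eV !rmorph1 mulr1.
- rewrite -/(td i) trig_to_loc_d loc_to_trig_in (rmorph_cherednik rat_to_trig) rat_to_trig_scal td_cherednik.
  have -> : rat_to_trig \o rc = tc by apply/funext => j; exact: (rat_to_trig_gen (RC j)).
  have -> : rat_to_trig \o rs = ts by apply/funext => j; exact: (rat_to_trig_gen (RS j)).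
  have -> : rat_to_trig \o rx = tx by apply/funext => j; exact: (rat_to_trig_gen (RX j)).
  by have -> : rat_to_trig \o ry = te by apply/funext => j; exact: (rat_to_trig_gen (RY j)).
- by rewrite -/(tc i) trig_to_loc_c loc_to_trig_in (rat_to_trig_gen (RC i)).
- by rewrite -/(ts p) trig_to_loc_s loc_to_trig_in (rat_to_trig_gen (RS p)).
Qed.

End LocToTrig.

Lemma inL_inj : injective inL.
Proof.
move=> a b /eqP; rewrite -subr_eq0 -(rmorphB inL) => /eqP.
rewrite inLE => /frac_eq[p]; rewrite mulr0 addn0 => E.
suff : a - b = 0 by apply: subr0_eq.
elim: p E => [|p IHp]; first by rewrite mul1r.
by rewrite exprS -mulrA => /ry_prod_regular.
Qed.

(** The composition with the map to the localization is the canonical map, which is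
    injective because z is not a zero divisor. *)
Lemma rat_to_trig_inj : injective rat_to_trig.
Proof. by move=> a b ab; apply: inL_inj; rewrite -!trig_to_loc_rat_to_trig ab. Qed.

Let exch_lt (i k : 'I_n) : (k < i)%N ->
  (1 - tc i * tc k) * ts (tperm k i) = exch tc ts i k.
Proof.
by move=> ki; rewrite (exchE (ta_cs (tdaha_action n u))) // -val_eqE /= gtn_eqF.
Qed.

Lemma rat_to_trigP : iota_spec rat_to_trig.
Proof.
split; first split.
- exact: rat_to_trig_scal.
- move=> p a; apply: pres_lift_homogeneous.
  have hgen g : homogeneous (@todd n) (todd g) (pgen (tdaha_rel u) g).
    exact: homogeneous_gen.
  case=> [i|i|i|q]; [|exact: (hgen (TE i))|exact: (hgen (TC i))|exact: (hgen (TS q))].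
  apply: (homogeneousM (p := false) (q := false)); first exact: (hgen (TEV i)).
  apply: homogeneousD; first exact: (hgen (TD i)).
  apply/homogeneousN/(homogeneousM (p := false) (q := false)).
    exact: homogeneous_scal.
  rewrite jucys_def; apply: homogeneous_sum => k _; rewrite exch_def.
  apply: (homogeneousM (p := false) (q := false)); last exact: (hgen (TS _)).
  apply: homogeneousD; first exact: homogeneous1.
  exact: (homogeneousM (hgen (TC k)) (hgen (TC i))).
- move=> a; apply: (@pres_hom_ext _ _ _ _
    (rat_to_trig \o sergeev_rdaha u : {rmorphism sergeev K n -> B}) (sergeev_tdaha u)) => [k|g].
    rewrite [RHS]pres_lift_scal; apply: etrans (rat_to_trig_scal k).
    by congr (rat_to_trig _); exact: pres_lift_scal.
  change (rat_to_trig (sergeev_rdaha u (pgen (@sergeev_rel K n) g)) =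
    sergeev_tdaha u (pgen (@sergeev_rel K n) g)); rewrite !pres_lift_gen.
  by case: g => [i|p]; [exact: (rat_to_trig_gen (RC i))|exact: (rat_to_trig_gen (RS p))].
- by move=> i; exact: (rat_to_trig_gen (RY i)).
- move=> i; rewrite (rat_to_trig_gen (RX i)) /= /tx jucys_def; congr (_ * (_ - _ * _)).
  by apply: eq_bigr => k /exch_lt.
Qed.

Lemma rat_to_trig_unique f : iota_spec f -> f =1 rat_to_trig.
Proof.
case: rat_to_trigP => [[iK _] iS iy ix] [[fK _] fS fy fx].
apply: pres_hom_ext => [k|g]; first by rewrite fK iK.
case: g => [i|i|i|p].
- by rewrite -/(rx i) fx ix.
- by rewrite -/(ry i) fy iy.
- have := fS (pgen _ (SC i)); rewrite -iS.
  by have -> : sergeev_rdaha u (pgen _ (SC i)) = rc i by exact: pres_lift_gen.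
- have := fS (pgen _ (SS p)); rewrite -iS.
  by have -> : sergeev_rdaha u (pgen _ (SS p)) = rs p by exact: pres_lift_gen.
Qed.

Lemma trig_to_locP : j_spec trig_to_loc.
Proof.
split=> [a|i|i].
- by have [_ <- _ _] := rat_to_trigP; rewrite trig_to_loc_rat_to_trig.
- exact: trig_to_loc_e.
rewrite trig_to_loc_d /cherednik jucys_def; congr (inL (_ + _ * _)).
apply: eq_bigr => k ki.
have [ra _] := rdaha_action n u.
by rewrite (exchE (ra_cs ra)) // -val_eqE /= gtn_eqF.
Qed.

Theorem rational_trigonometric_isomorphism :
  exists f : {rmorphism rdaha n u -> tdaha n u},
    [/\ iota_spec f,
        forall f' : {rmorphism rdaha n u -> tdaha n u}, iota_spec f' -> f' =1 f,
        injective f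
      & exists (f_loc : {rmorphism rdaha_loc n u -> tdaha n u})
               (j : {rmorphism tdaha n u -> rdaha_loc n u}),
          [/\ fixes_scalars f_loc,
              forall a, f_loc (rdaha_to_loc u a) = f a,
              cancel f_loc j,
              cancel j f_loc
            & j_spec j]].
Proof.
have [v [zv vz]] := rat_to_trig_ry_prod_unit.
exists rat_to_trig; split; [exact: rat_to_trigP|exact: rat_to_trig_unique|exact: rat_to_trig_inj|].
exists (loc_to_trig zv vz), trig_to_loc; split.
- exact: loc_to_trig_scal.
- exact: loc_to_trig_in.
- exact: loc_to_trigK.
- exact: trig_to_locK.
- exact: trig_to_locP.
Qed.

End Isomorphism.

Theorem theorem5p2 (R : realType) (n : nat) (u : R[i])
    (hn : (1 <= n)%N) (hu : u != 0) :
  exists iota : {rmorphism rdaha n u -> tdaha n u},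
    [/\ iota_spec iota,
        forall iota' : {rmorphism rdaha n u -> tdaha n u},
          iota_spec iota' -> iota' =1 iota,
        injective iota
      & exists (iota_loc : {rmorphism rdaha_loc n u -> tdaha n u})
               (j : {rmorphism tdaha n u -> rdaha_loc n u}),
          [/\ fixes_scalars iota_loc,
              forall a, iota_loc (rdaha_to_loc u a) = iota a,
              cancel iota_loc j,
              cancel j iota_loc
            & j_spec j]].
Proof. exact: rational_trigonometric_isomorphism. Qed.
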